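(* Let $w:I\to(0,\infty)$ be a decreasing weight on $I=(0,a)$, $0<a\le\infty$, let $b=\int_I w\,dm\in(0,\infty]$, $J=(0,b)$, and let $E$ be a fully symmetric Banach function space on $J$ with support $J$. For any $f\in M_{E,w}$, $$\|f\|_{M_{E,w}}=\inf\left\{\left\|\frac fv\right\|_{E_v}: v\ge0,\ v^*=w,\ \mathrm{supp}\,v\supset\mathrm{supp}\,f\right\},$$ with the convention that the norm is $\infty$ for elements outside the space, and $f(t)/v(t)=0$ whenever $f(t)=0$. Moreover, if $W(t)=\int_0^t w\,dm<\infty$ for all $t\in I$, then a function $f\in L^0(I)$ belongs to $M_{E,w}$ if and only if $\frac fv\circ V^{-1}\in E$ for some measurable $v\ge0$ on $I$ with $v^*=w$ and $\mathrm{supp}\,v\supset\mathrm{supp}\,f$, where $V(t)=\int_0^t v\,dm$.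
   Context: $m$ is Lebesgue measure; functions are identified when equal a.e.; ''decreasing'' means non-increasing. $L^0(I)$ is the space of real Lebesgue measurable functions on $I$. For a measure $\mu$ and a $\mu$-measurable $f$ on $\Omega$, $d_f^\mu(s)=\mu\{|f|>s\}$ and $f^{*,\mu}(t)=\inf\{s>0:d_f^\mu(s)\le t\}$ for $0\le t<\mu(\Omega)$; $f^*$ is the rearrangement for $\mu=m$, and $f^{*,v}$ the rearrangement with respect to the measure $v\,dm$ on $I$, for measurable $v\ge0$. If $v^*=w$ then $\int_I v\,dm=b$, so $f^{*,v}$ is a function on $J$. For functions on $J$, $g\prec h$ means $\int_0^x g^*\,dm\le\int_0^x h^*\,dm$ for all $x\in J$. A Banach function space on $J$ is a solid linear subspace $E$ of $L^0(J)$ with full support, complete under a monotone norm ($|f|\le|g|$ a.e. implies $\|f\|_E\le\|g\|_E$). It is fully symmetric if equimeasurable functions have equal norms and $f\prec g$, $f\in L^0(J)$, $g\in E$ imply $f\in E$ and $\|f\|_E\le\|g\|_E$. ''Support $J$'' means $\chi_A\in E$ whenever $m(A)<\infty$. For $v\ge 0$ measurable on $I$ with $\int_I v\,dm=b$ (in particular $v=w$): $E_v=\{f:f^{*,v}\in E\}$, $\|f\|_{E_v}=\|f^{*,v}\|_E$. The class $M_{E,w}$ (not necessarily a linear space) and its gauge are $M_{E,w}=\{f\in L^0(I): f^*/w\in E_w\}$, $\|f\|_{M_{E,w}}=\|f^*/w\|_{E_w}$. When $v\ge0$, $v^*=w$ and $V(t)=\int_0^t v\,dm<\infty$ for $t\in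 I$, $V$ is a continuous increasing map of $I$ onto $J$ (up to endpoints). Let $N_v=\{t\in J: m(V^{-1}\{t\})>0\}$ (at most countable). For $g\in L^0(I)$ with $\mathrm{supp}\,g\subset\mathrm{supp}\,v$, $g\circ V^{-1}$ is the function on $J$ defined by $g\circ V^{-1}(t)=0$ if $t\in N_v$ and $g\circ V^{-1}(t)=g(V^{-1}(t))$ if $t\in J\setminus N_v$, where $V^{-1}(t)$ is then the unique preimage of $t$. *)

(* Defs.v *)
From HB Require Import structures.
From mathcomp Require Import all_boot all_order all_algebra.
From mathcomp Require Import all_classical all_reals all_analysis.

Set Implicit Arguments.
Unset Strict Implicit.
Unset Printing Implicit Defensive.

Import Order.TTheory GRing.Theory Num.Theory.
Import numFieldNormedType.Exports.

Local Open Scope classical_set_scope.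
Local Open Scope ring_scope.
Local Open Scope ereal_scope.

(* R with the sigma-algebra of Lebesgue (not merely Borel) measurable sets,
   i.e. the domain of completed_lebesgue_measure. *)
Definition lebR (R : realType) := caratheodory_type ((@wlength R idfun)^*)%mu.

Definition leb (R : realType) : {measure set (lebR R) -> \bar R} :=
  @completed_lebesgue_measure R.

(* (0, c) for 0 < c <= +oo. *)
Definition oint (R : realType) (c : \bar R) : set R :=
  [set x : R | (0 < x)%R /\ x%:E < c].

(* Functions on D are total functions on R whose values outside D are
   irrelevant; the identification of a.e. equal functions is not built into the
   type but obtained from the axioms below. *)
Definition L0 (R : realType) (D : set R) (f : R -> R) : Prop :=
  measurable_fun (D : set (lebR R)) (f : lebR R -> measurableTypeR R).

(* An extended-real-valued function (such as a rearrangement, which may be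
   infinite) belongs to a class P of real functions on D, when functions are
   identified a.e. on D. *)
Definition ae_in (R : realType) (D : set R) (P : set (R -> R))
    (f : R -> \bar R) : Prop :=
  exists2 h : R -> R, P h &
    {ae leb R, forall x, D x -> f x = (h x)%:E}.

Definition distr (R : realType) (mu : set R -> \bar R) (D : set R)
    (f : R -> \bar R) (s : R) : \bar R :=
  mu [set x | D x /\ s%:E < `|f x|].

(* f^{*,mu} for f on D; it is +oo at t when no s > 0 qualifies. *)
Definition rearr (R : realType) (mu : set R -> \bar R) (D : set R)
    (f : R -> \bar R) (t : R) : \bar R :=
  ereal_inf [set s%:E | s in [set s : R | (0 < s)%R /\ distr mu D f s <= t%:E]].

(* The measure v dm. *)
Definition wmeas (R : realType) (v : R -> R) (A : set R) : \bar R :=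
  \int[leb R]_(x in A) (v x)%:E.

(* t |-> \int_0^t v dm *)
Definition primitive (R : realType) (v : R -> R) (t : R) : \bar R :=
  \int[leb R]_(x in oint t%:E) (v x)%:E.

(* g -< h *)
Definition submaj (R : realType) (J : set R) (g h : R -> R) : Prop :=
  forall x : R, J x ->
    \int[leb R]_(t in oint x%:E) rearr (leb R) J (EFin \o g) t <=
    \int[leb R]_(t in oint x%:E) rearr (leb R) J (EFin \o h) t.

(* bfs_norm is only meaningful on bfs_mem. Invariance of bfs_mem and bfs_norm
   under a.e. equality on J is a consequence of bfs_solid. *)
Record banach_fun_space (R : realType) (J : set R) := BanachFunSpace {
  bfs_mem : set (R -> R) ;
  bfs_norm : (R -> R) -> R ;
  bfs_L0 : forall f, bfs_mem f -> L0 J f ;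
  bfs_zero : bfs_mem (fun=> 0%R) ;
  bfs_add : forall f g, bfs_mem f -> bfs_mem g ->
    bfs_mem (fun x => f x + g x)%R ;
  bfs_scale : forall (c : R) f, bfs_mem f -> bfs_mem (fun x => c * f x)%R ;
  bfs_solid : forall f g, L0 J f -> bfs_mem g ->
    {ae leb R, forall x, J x -> (`|f x| <= `|g x|)%R} ->
    bfs_mem f /\ (bfs_norm f <= bfs_norm g)%R ;
  bfs_norm_ge0 : forall f, bfs_mem f -> (0 <= bfs_norm f)%R ;
  bfs_norm_eq0 : forall f, bfs_mem f -> bfs_norm f = 0%R ->
    {ae leb R, forall x, J x -> f x = 0%R} ;
  bfs_normD : forall f g, bfs_mem f -> bfs_mem g ->
    (bfs_norm (fun x => f x + g x) <= bfs_norm f + bfs_norm g)%R ;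
  bfs_normZ : forall (c : R) f, bfs_mem f ->
    (bfs_norm (fun x => c * f x) = `|c| * bfs_norm f)%R ;
  bfs_complete : forall u : nat -> R -> R,
    (forall n, bfs_mem (u n)) ->
    (forall e : R, (0 < e)%R -> exists N : nat, forall m n : nat,
      (N <= m)%N -> (N <= n)%N ->
      (bfs_norm (fun x => u m x - u n x) < e)%R) ->
    exists2 f, bfs_mem f &
      (fun n => bfs_norm (fun x => u n x - f x)%R) @ \oo --> (0%R : R) ;
  bfs_support : forall A : set R, measurable (A : set (lebR R)) ->
    A `<=` J -> leb R A < +oo -> bfs_mem (\1_A : R -> R)
}.

Definition fully_symmetric (R : realType) (J : set R)
    (E : banach_fun_space J) : Prop :=
  (forall f g, bfs_mem E f -> L0 J g ->
     (forall s : R, distr (leb R) J (EFin \o g) s =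
                    distr (leb R) J (EFin \o f) s) ->
     bfs_mem E g /\ bfs_norm E g = bfs_norm E f) /\
  (forall f g, L0 J f -> bfs_mem E g -> submaj J f g ->
     bfs_mem E f /\ (bfs_norm E f <= bfs_norm E g)%R).

(* f \in E_v, for f defined a.e. on I *)
Definition in_Ev (R : realType) (I J : set R) (E : banach_fun_space J)
    (v : R -> R) (f : R -> \bar R) : Prop :=
  ae_in I (L0 I) f /\ ae_in J (bfs_mem E) (rearr (wmeas v) I f).

Definition normEv (R : realType) (I J : set R) (E : banach_fun_space J)
    (v : R -> R) (f : R -> \bar R) : \bar R :=
  if `[< in_Ev I E v f >] then
    (bfs_norm E (fun t => fine (rearr (wmeas v) I f t)))%:E
  else +oo.

(* f^* / w *)
Definition rearr_over (R : realType) (I : set R) (w f : R -> R) (t : R) :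
    \bar R :=
  rearr (leb R) I (EFin \o f) t * ((w t)^-1)%:E.

Definition in_M (R : realType) (I J : set R) (E : banach_fun_space J)
    (w f : R -> R) : Prop :=
  L0 I f /\ in_Ev I E w (rearr_over I w f).

Definition normM (R : realType) (I J : set R) (E : banach_fun_space J)
    (w f : R -> R) : \bar R :=
  if `[< in_M I E w f >] then normEv I E w (rearr_over I w f) else +oo.

(* The weights v over which the infimum is taken. *)
Definition admissible (R : realType) (I : set R) (w f v : R -> R) : Prop :=
  [/\ L0 I v,
      forall x, I x -> (0 <= v x)%R,
      {ae leb R, forall t, I t -> rearr (leb R) I (EFin \o v) t = (w t)%:E} &
      {ae leb R, forall x, I x -> f x != 0%R -> v x != 0%R}].

(* As x / 0 = 0, this is 0 whenever f t = 0, whatever v t is. *)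
Definition quot (R : realType) (f v : R -> R) (t : R) : R := (f t / v t)%R.

Definition Vfiber (R : realType) (I : set R) (v : R -> R) (t : R) : set R :=
  [set x | I x /\ primitive v x = t%:E].

(* g \o V^{-1}; for t outside N_v the fiber is a singleton, from which xget
   extracts the preimage (the default 0 is not used for t in J). *)
Definition comp_Vinv (R : realType) (I : set R) (v g : R -> R) (t : R) : R :=
  if `[< 0 < leb R (Vfiber I v t) >] then 0%R
  else g (xget 0%R (Vfiber I v t)).

(* Main.v *)
(* Upper bound for the gauge: for the distribution functions d1 of f^*/w with
   respect to w dm and d2 of f/v with respect to v dm, Tonelli gives
   int_l^oo d1 = int_0^oo m{l w <= u < f^*} du, and likewise for d2, |f| and v.
   As v and w are equimeasurable, m{l w <= u < f^*} <= m{l v <= u < |f|}, so the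
   tails of d1 are dominated by those of d2, which is the submajorization
   (f^*/w)^{*,w} -< (f/v)^{*,v}.

   Lower bound: for theta > 1, cut the values of |f| into bands
   [theta^k, theta^(k+1)) and send each band, from left to right, onto the
   corresponding interval of the graph of f^*. This is a measure-preserving map
   sigma with |f| <= theta (f^* o sigma), so v = w o sigma is admissible and
   d2(s) <= d1(s / theta). If f^*(oo) > 0, the values of |f| below a level
   slightly above f^*(oo) form a single last band; this is why the infimum need
   not be attained by this construction.

   For the second claim, V transports v dm to Lebesgue measure on J, so that
   (f/v) o V^{-1} and f/v are equimeasurable; and an element g of E satisfies
   int_0^x g^* < oo, since otherwise every multiple of a characteristic function
   would be submajorized by g, which gives the finiteness of f^*. *)
Require Import Defs.
From HB Require Import structures.
From mathcomp Require Import all_boot all_order all_algebra.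
From mathcomp Require Import all_classical all_reals all_analysis.
From mathcomp Require Import measurable_realfun measurable_fun_approximation.
From mathcomp Require Import lra.

Import Order.TTheory GRing.Theory Num.Theory.
Import numFieldNormedType.Exports.

Local Open Scope classical_set_scope.
Local Open Scope ring_scope.
Local Open Scope ereal_scope.

Set Implicit Arguments.
Unset Strict Implicit.
Unset Printing Implicit Defensive.

(** The map sigma is not glued from maps of single bands. Ordering the points by decreasing |f| and,
    at ties, from left to right is a lexicographic order, in general not the order induced by a real
    function. With countably many bands it becomes one: the band index plus a position in (0, 1) is
    a single real number q, injective on I, and sigma x is the measure of {q > q x}. The level sets
    of q being null, its distribution function is continuous, and this is what makes sigma preserve
    measure. The price is the factor theta. Ranks may be infinite, but only at zeros of f, where v
    is set to 0.

    Lebesgue measurability is not stable under composition, so transport of measure is proved for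
    Borel sets and, for the inverse of V, extended through null sets. Distribution functions are
    only right continuous, so lower bounds on rearrangements leave out a countable set of
    arguments. *)

(** * Lebesgue and Borel measurable sets, intervals, null sets *)

Lemma borel_leb (R : realType) (A : set R) :
  measurable (A : set (measurableTypeR R)) -> measurable (A : set (lebR R)).
Proof. exact: sub_caratheodory. Qed.

Lemma lebE (R : realType) (A : set R) : leb R A = lebesgue_measure A.
Proof. by []. Qed.

Lemma itv_leb (R : realType) (i : interval R) :
  measurable ([set` i] : set (lebR R)).
Proof. by apply: borel_leb; exact: measurable_itv. Qed.

Lemma is_interval_leb (R : realType) (A : set R) :
  is_interval A -> measurable (A : set (lebR R)).
Proof. by move=> iA; apply: borel_leb; exact: is_interval_measurable. Qed.


(** The outer function has to be Borel: the preimage of a Lebesgue measurable set under a measurable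
    function need not be measurable. *)
Lemma borel_comp_leb d (T : measurableType d) (R : realType) (D E : set R)
    (f : R -> R) (g : R -> T) :
  measurable (E : set (measurableTypeR R)) ->
  measurable_fun (D : set (lebR R)) (f : lebR R -> measurableTypeR R) ->
  (forall x, D x -> E (f x)) ->
  measurable_fun (E : set (measurableTypeR R)) g ->
  measurable_fun (D : set (lebR R)) (g \o f : lebR R -> T).
Proof.
move=> mE mf DE mg; apply: (measurable_comp mE _ mg mf).
by move=> _ [x /DE Ex <-].
Qed.

Lemma measurable_id_leb (R : realType) (D : set R) : 
  measurable_fun (D : set (lebR R)) (id : lebR R -> measurableTypeR R).
Proof. by move=> mD B mB; apply: measurableI => //; exact: borel_leb. Qed.

Lemma borel_fun_leb d (T : measurableType d) (R : realType) (D : set R)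
    (f : R -> T) : measurable (D : set (measurableTypeR R)) ->
  measurable_fun (D : set (measurableTypeR R)) f ->
  measurable_fun (D : set (lebR R)) (f : lebR R -> T).
Proof.
by move=> mD mf; apply: (@borel_comp_leb _ _ _ D D id f mD) => //; exact: measurable_id_leb.
Qed.

Lemma is_interval_oint (R : realType) (c : \bar R) : is_interval (oint c).
Proof.
move=> x y [x0 _] [_ yc] z /andP[xz zy]; split; first exact: lt_le_trans xz.
by apply: le_lt_trans yc; rewrite lee_fin.
Qed.

Lemma measurable_oint (R : realType) (c : \bar R) :
  measurable (oint c : set (measurableTypeR R)).
Proof. by apply: is_interval_measurable; exact: is_interval_oint. Qed.

Lemma leb_oint (R : realType) (c : \bar R) : 0 <= c -> leb R (oint c) = c.
Proof.
rewrite lebE; case: c => [c| |]//= c0.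
- rewrite (_ : oint _ = `]0%R, c[%classic); last first.
    by apply/seteqP; split=> x; rewrite /oint /= in_itv/= lte_fin => /andP.
  rewrite lebesgue_measure_itv/= lte_fin; case: ifPn => [_|]; first by rewrite oppr0 adde0.
  rewrite -leNgt => c0'; congr EFin; apply/eqP; rewrite eq_le -lee_fin c0/=//.
- rewrite (_ : oint _ = `]0%R, +oo[%classic); last first.
    by apply/seteqP; split=> x; rewrite /oint /= in_itv/= andbT ?ltry// => -[].
  by rewrite lebesgue_measure_itv/= ltry.
Qed.

Lemma ointI (R : realType) (c d : \bar R) :
  oint c `&` oint d = oint (Order.min c d).
Proof.
apply/seteqP; split=> x; rewrite /oint/= lt_min.
  by move=> [[-> ->] [_ ->]].
by move=> [-> /andP[-> ->]].
Qed.

Lemma le_oint (R : realType) (c d : \bar R) : c <= d -> oint c `<=` oint d.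
Proof. by move=> cd x [x0 xc]; split => //; exact: lt_le_trans cd. Qed.

Lemma leb_set1 (R : realType) (x : R) : leb R [set x] = 0.
Proof. by rewrite lebE lebesgue_measure_set1. Qed.

Lemma leb_countable (R : realType) (A : set R) : countable A -> leb R A = 0.
Proof. by move=> cA; rewrite lebE countable_lebesgue_measure0. Qed.

Lemma negligible_leb (R : realType) (N : set R) :
  (leb R).-negligible (N : set (lebR R)) -> measurable (N : set (lebR R)).
Proof. exact: completed_lebesgue_measure_is_complete. Qed.

(** By completeness the part of [B] inside [N] is measurable, whatever it is; outside [N] it
    coincides with [A]. *)
Lemma leb_ae_measurable (R : realType) (A B N : set R) :
  (leb R).-negligible (N : set (lebR R)) -> measurable (A : set (lebR R)) ->
  (forall x, ~ N x -> A x <-> B x) -> measurable (B : set (lebR R)).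
Proof.
move=> nN mA AB.
have -> : B = (A `&` ~` N) `|` (B `&` N).
  apply/seteqP; split=> x.
    by case: (pselect (N x)) => Nx Bx; [right|left; split => //; apply/AB].
  by move=> [[Ax Nx]|[]//]; apply/AB.
apply: measurableU.
  by apply: measurableI => //; apply: measurableC; exact: negligible_leb.
by apply: negligible_leb; apply: negligibleS nN => x [].
Qed.

Lemma measure_eq_off d (T : measurableType d) (R : realType)
    (mu : {measure set T -> \bar R}) (A B N : set T) :
  measurable A -> measurable B -> measurable N -> mu N = 0 ->
  (forall x, ~ N x -> A x <-> B x) -> mu A = mu B.
Proof.
move=> mA mB mN N0 AB.
have E C : measurable C -> mu C = mu (C `&` ~` N).
  move=> mC; have mCN : measurable (C `&` ~` N).
    by apply: measurableI => //; exact: measurableC.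
  apply/eqP; rewrite eq_le; apply/andP; split; last first.
    by apply: le_measure; rewrite ?inE.
  rewrite -[leRHS]adde0 -[X in _ <= _ + X]N0.
  have sC : C `<=` (C `&` ~` N) `|` N.
    by move=> x Cx; case: (pselect (N x)) => Nx; [right|left].
  apply: (le_trans (le_measure _ _ _ sC)); rewrite ?inE//; first exact: measurableU.
  exact: measureU2.
rewrite (E A)// (E B)//; congr (mu _).
by apply/seteqP; split=> x [h Nx]; split => //; exact/AB.
Qed.

Lemma leb_ae_eq (R : realType) (A B N : set R) :
  (leb R).-negligible (N : set (lebR R)) -> measurable (A : set (lebR R)) ->
  (forall x, ~ N x -> A x <-> B x) -> leb R A = leb R B.
Proof.
move=> nN mA AB; have mN := negligible_leb nN.
exact: (measure_eq_off mA (leb_ae_measurable nN mA AB) mN (measure_negligible mN nN) AB).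
Qed.

(** Superlevel sets of a monotone function on an interval are intervals. *)
Lemma nonincreasing_emeasurable (R : realType) (D : set R) (f : R -> \bar R) :
  is_interval D -> (forall s t, D s -> D t -> (s <= t)%R -> f t <= f s) ->
  measurable_fun (D : set (measurableTypeR R)) f.
Proof.
move=> iD ndf mD; apply: (measurability _ (ErealGenOInfty.measurableE R)) => // _ [_ [r ->] <-].
apply: is_interval_measurable => s t/=; rewrite !in_itv/= !andbT => -[Ds rs] [Dt rt] u /andP[su ut].
have Du : D u by apply: (iD s t) => //; rewrite su.
by split=> //; rewrite in_itv/= andbT; apply: lt_le_trans rt _; exact: ndf.
Qed.

Lemma ae_lebP (R : realType) (P : R -> Prop) :
  {ae leb R, forall x, P x} <-> (leb R).-negligible ([set x | ~ P x] : set (lebR R)).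
Proof. by []. Qed.

Lemma ae_leb_mono (R : realType) (P Q : R -> Prop) :
  (forall x, P x -> Q x) -> {ae leb R, forall x, P x} -> {ae leb R, forall x, Q x}.
Proof.
move=> PQ /ae_lebP nP; apply/ae_lebP; apply: negligibleS nP => x /= nQ /PQ.
exact: nQ.
Qed.

Lemma ae_leb_and (R : realType) (P Q : R -> Prop) :
  {ae leb R, forall x, P x} -> {ae leb R, forall x, Q x} ->
  {ae leb R, forall x, P x /\ Q x}.
Proof.
move=> /ae_lebP nP /ae_lebP nQ; apply/ae_lebP.
apply: negligibleS (negligibleU nP nQ) => x /= nPQ.
by case: (pselect (P x)) => Px; [right|left] => // Qx; apply: nPQ.
Qed.

Lemma negligible_countable (R : realType) (A : set R) :
  countable A -> (leb R).-negligible (A : set (lebR R)).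
Proof.
move=> cA; apply/(negligibleP (leb R)); last exact: leb_countable.
by apply: borel_leb; apply: countable_measurable.
Qed.

Lemma ae_leb_countable (R : realType) (A : set R) (P : R -> Prop) :
  countable A -> (forall x, ~ A x -> P x) -> {ae leb R, forall x, P x}.
Proof.
move=> cA AP; apply/ae_lebP; apply: negligibleS (negligible_countable cA) => x /= nP.
by apply: contrapT => /AP.
Qed.

(** * Distribution functions and decreasing rearrangements *)

(** Continuity from below along s + 1/(n+1), which needs no finiteness: this is right continuity of
    the distribution function. *)
Lemma superlevel_right d (T : measurableType d) (R : realType)
    (mu : {measure set T -> \bar R}) (D : set T) (y : T -> \bar R)
    (s : R) (t : \bar R) :
  measurable D -> measurable_fun D y ->
  t < mu [set x | D x /\ s%:E < y x] ->
  exists2 s', (s < s')%R & t < mu [set x | D x /\ s'%:E < y x].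
Proof.
move=> mD my ts; apply: contrapT => nex.
pose F n := [set x | D x /\ (s + n.+1%:R^-1)%:E < y x].
have mF n : measurable (F n) by exact: emeasurable_fun_o_infty.
have UF : \bigcup_n F n = [set x | D x /\ s%:E < y x].
  apply/seteqP; split=> [x [n _ [Dx sy]]|x [Dx]].
    by split => //; apply: le_lt_trans sy; rewrite lee_fin lerDl.
  case E : (y x) => [r| |]// sr; last by exists 0%N => //; split => //; rewrite E ltry.
  have /ltr_add_invr[n snr] : (s < r)%R by [].
  by exists n => //; split=> //; rewrite E lte_fin.
have ndF : nondecreasing_seq F.
  move=> n m nm; apply/subsetPset => x [Dx sy]; split => //.
  by apply: le_lt_trans sy; rewrite lee_fin lerD2l lef_pV2 ?posrE// ler_nat ltnS.
have cF := @nondecreasing_cvg_mu _ _ _ mu _ mF (bigcupT_measurable _ mF) ndF.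
move: ts; rewrite -UF -(cvg_lim _ cF)// ltNge => /negP; apply.
apply: lime_le; first by apply/cvg_ex; eexists; exact: cF.
apply: nearW => n /=; rewrite leNgt; apply/negP => tF; apply: nex.
by exists (s + n.+1%:R^-1)%R => //; rewrite ltrDl.
Qed.

(** Continuity from above along s - (s - c)/(n+1). These levels start at [c], where the measure is
    finite, and their superlevel sets decrease to the one with a weak inequality. *)
Lemma superlevel_left d (T : measurableType d) (R : realType)
    (mu : {measure set T -> \bar R}) (D : set T) (y : T -> R)
    (c s : R) (t : \bar R) :
  measurable D -> measurable_fun D y -> (c < s)%R ->
  mu [set x | D x /\ (c < y x)%R] < +oo ->
  mu [set x | D x /\ (s <= y x)%R] < t ->
  exists2 s', (c <= s' < s)%R & mu [set x | D x /\ (s' < y x)%R] < t.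
Proof.
move=> mD my cs cfin st; apply: contrapT => nex.
pose u n := (s - (s - c) * n.+1%:R^-1)%R.
have cu n : (c <= u n < s)%R.
  rewrite /u ltrBlDr ltrDl mulr_gt0 ?subr_gt0 ?invr_gt0// andbT.
  by rewrite lerBrDr -lerBrDl ler_piMr ?subr_ge0 ?(ltW cs)// invf_le1 ?ler1n.
pose F n := [set x | D x /\ (u n < y x)%R].
have mF n : measurable (F n).
  by have := measurable_fun_ltr (measurable_cst (u n)) my => /(_ mD [set true] I).
have UF : \bigcap_n F n = [set x | D x /\ (s <= y x)%R].
  apply/seteqP; split=> [x Fx|x [Dx sy] n _].
    split; first by have [] := Fx 0%N I.
    rewrite leNgt; apply/negP => ys.
    have : (0 < (s - y x) / (s - c))%R by rewrite divr_gt0 ?subr_gt0.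
    move=> /ltr_add_invr[n]; rewrite add0r ltr_pdivlMr ?subr_gt0// => h.
    have [_] := Fx n I; rewrite /u ltrBlDr -ltrBlDl => h'.
    by have := lt_trans h h'; rewrite mulrC ltxx.
  by split => //; apply: lt_le_trans sy; have /andP[] := cu n.
have niF : nonincreasing_seq F.
  move=> n m nm; apply/subsetPset => x [Dx sy]; split => //.
  apply: le_lt_trans sy; rewrite lerD2l lerN2 ler_wpM2l ?subr_ge0 ?(ltW cs)//.
  by rewrite lef_pV2 ?posrE// ler_nat ltnS.
have F0 : mu (F 0%N) < +oo.
  apply: le_lt_trans cfin; apply: le_measure; rewrite ?inE//.
    by have := measurable_fun_ltr (measurable_cst c) my => /(_ mD [set true] I).
  by move=> x [Dx ux]; split => //; apply: le_lt_trans ux; have /andP[] := cu 0%N.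
have cF := @nonincreasing_cvg_mu _ _ _ mu _ F0 mF (bigcapT_measurable mF) niF.
move: st; rewrite -UF -(cvg_lim _ cF)// ltNge => /negP; apply.
apply: lime_ge; first by apply/cvg_ex; eexists; exact: cF.
apply: nearW => n /=; rewrite leNgt; apply/negP => tF; apply: nex.
by exists (u n).
Qed.


Section rearr.
Context (R : realType) (mu : {measure set (lebR R) -> \bar R}) (D : set R).
Hypothesis mD : measurable (D : set (lebR R)).
Implicit Types (f : R -> \bar R) (s t : R).

Lemma measurable_distr_set f s : measurable_fun (D : set (lebR R)) f ->
  measurable ([set x | D x /\ s%:E < `|f x|] : set (lebR R)).
Proof.
move=> mf; have mf' : measurable_fun (D : set (lebR R)) (abse \o f).
  exact: (measurableT_comp (@abse_measurable R setT) mf).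
exact: (emeasurable_fun_o_infty mD mf').
Qed.

Lemma le_distr f s s' : measurable_fun (D : set (lebR R)) f ->
  (s <= s')%R -> distr mu D f s' <= distr mu D f s.
Proof.
move=> mf ss'; apply: le_measure; rewrite ?inE; try exact: measurable_distr_set.
by move=> x [Dx sf]; split => //; apply: le_lt_trans sf; rewrite lee_fin.
Qed.

Lemma distr_right f s (t : \bar R) : measurable_fun (D : set (lebR R)) f ->
  t < distr mu D f s -> exists2 s', (s < s')%R & t < distr mu D f s'.
Proof.
move=> mf; have mf' : measurable_fun (D : set (lebR R)) (abse \o f).
  exact: (measurableT_comp (@abse_measurable R setT) mf).
exact: (superlevel_right mD mf').
Qed.

End rearr.

Lemma le_rearr (R : realType) (mu : set R -> \bar R) (D : set R) f (s t : R) :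
  (s <= t)%R -> rearr mu D f t <= rearr mu D f s.
Proof.
move=> st; apply: ereal_inf_le_tmp => _ [r [r0 rs] <-]; exists r => //.
by split => //; apply: le_trans rs _; rewrite lee_fin.
Qed.

Lemma rearr_ge0 (R : realType) (mu : set R -> \bar R) (D : set R) f (t : R) :
  0 <= rearr mu D f t.
Proof. by apply: le_ereal_inf_tmp => _ [r [r0 _] <-]; rewrite lee_fin ltW. Qed.

Lemma eq_rearr (R : realType) (mu mu' : set R -> \bar R) (D D' : set R) f f' :
  (forall s, (0 < s)%R -> distr mu D f s = distr mu' D' f' s) ->
  rearr mu D f = rearr mu' D' f'.
Proof.
move=> e; apply/funext => t; congr ereal_inf; apply/seteqP.
by split=> _ [r [r0 dr] <-]; exists r => //; split => //; rewrite ?e// -e.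
Qed.

Lemma rearr_le (R : realType) (mu : set R -> \bar R) (D : set R) f (s t : R) :
  (0 < s)%R -> distr mu D f s <= t%:E -> rearr mu D f t <= s%:E.
Proof. by move=> s0 ds; apply: ereal_inf_lbound; exists s. Qed.

(** Right continuity of the distribution function turns the definition of the rearrangement as an
    infimum into an exact equivalence of strict inequalities. *)
Lemma rearr_gtP (R : realType) (mu : {measure set (lebR R) -> \bar R})
    (D : set R) (f : R -> \bar R) (s t : R) :
  measurable (D : set (lebR R)) -> measurable_fun (D : set (lebR R)) f ->
  (0 <= s)%R -> (s%:E < rearr mu D f t) = (t%:E < distr mu D f s).
Proof.
move=> mD mf s0; apply/idP/idP => [sr|/(distr_right mD mf)[s' ss' ts']].
  rewrite ltNge; apply/negP => dt; move: sr; rewrite ltNge => /negP; apply.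
  apply/lee_addgt0Pr => e e0; rewrite -EFinD; apply: rearr_le; first by rewrite ltr_wpDl.
  by apply: le_trans dt; apply: le_distr => //; rewrite lerDl ltW.
apply: (@lt_le_trans _ _ s'%:E); rewrite ?lte_fin//.
apply: le_ereal_inf_tmp => _ [r [r0 dr] <-]; rewrite lee_fin leNgt; apply/negP => rs'.
move: ts'; rewrite ltNge => /negP; apply; apply: le_trans dr.
by apply: le_distr => //; exact: ltW.
Qed.

Lemma measurable_rearr (R : realType) (mu : set R -> \bar R) (D A : set R) f :
  measurable (A : set (measurableTypeR R)) ->
  measurable_fun (A : set (measurableTypeR R)) (rearr mu D f).
Proof.
move=> mA; apply: measurable_funS (_ : measurable_fun setT _) => //.
by apply: nonincreasing_emeasurable => // s t _ _; exact: le_rearr.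
Qed.

Lemma measurable_rearr_leb (R : realType) (mu : set R -> \bar R) (D A : set R) f :
  measurable (A : set (measurableTypeR R)) ->
  measurable_fun (A : set (lebR R)) (rearr mu D f).
Proof. by move=> mA; apply: borel_fun_leb => //; exact: measurable_rearr. Qed.

(** By [rearr_gtP] the set is an initial interval of length [distr mu D f s], cut at [c]. When [c]
    is at least the mass of [D], this is the equimeasurability of a function and its
    rearrangement. *)
Lemma leb_rearr_gt (R : realType) (mu : {measure set (lebR R) -> \bar R})
    (D : set R) (f : R -> \bar R) (c : \bar R) (s : R) :
  measurable (D : set (lebR R)) -> measurable_fun (D : set (lebR R)) f ->
  (0 <= s)%R -> 0 <= c ->
  leb R [set t | oint c t /\ s%:E < rearr mu D f t] =
    Order.min (distr mu D f s) c.
Proof.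
move=> mD mf s0 c0; rewrite -[RHS]leb_oint; last by rewrite le_min c0 andbT measure_ge0.
rewrite minC -ointI; congr (leb R _); apply/seteqP; split=> t.
  by move=> [[t0 tc]]; rewrite rearr_gtP// => td; split.
by move=> [[t0 tc] [_ td]]; split; rewrite ?rearr_gtP.
Qed.

(* The exceptional [t] are countable. As the rearrangement is right-continuous,
   [t <= distr s] for [s < l] alone would not give [l <= rearr t]. *)
Lemma rearr_ge (R : realType) (mu : {measure set (lebR R) -> \bar R})
    (D : set R) (f : R -> \bar R) (l t : R) :
  measurable (D : set (lebR R)) -> measurable_fun (D : set (lebR R)) f ->
  (forall q : rat, t%:E <> distr mu D f (ratr q)) ->
  (forall s, (0 < s < l)%R -> t%:E <= distr mu D f s) ->
  l%:E <= rearr mu D f t.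
Proof.
move=> mD mf nt td; rewrite leNgt; apply/negP => rl.
have r0 := rearr_ge0 mu D f t.
have rE : rearr mu D f t = (fine (rearr mu D f t))%:E.
  by rewrite fineK// ge0_fin_numE// (lt_trans rl)// ltry.
rewrite rE in rl r0; set r := fine _ in rE rl r0.
have [q] := rat_in_itvoo (rl : (r < l)%R); rewrite in_itv/= => /andP[rq ql].
have q0 : (0 < ratr q :> R)%R by rewrite (le_lt_trans _ rq).
apply: (nt q); apply/eqP; rewrite eq_le td ?q0//= leNgt -rearr_gtP ?(ltW q0)//.
by rewrite rE -leNgt lee_fin ltW.
Qed.

Lemma countable_distr_rat (R : realType) (mu : set R -> \bar R) (D : set R) f :
  countable [set t : R | exists q : rat, t%:E = distr mu D f (ratr q)].
Proof.
apply: (@sub_countable _ _ _ [set fine (distr mu D f (ratr q)) | q in [set: rat]]).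
  by apply: subset_card_le => t [q tq]; exists q => //=; rewrite -tq.
by apply: (sub_countable (card_image_le _ _)); exact: countableP.
Qed.

(** * Tonelli, the layer-cake formula and tails of quotients *)

(** Tonelli for v(x) 1_Q(x, s) with [Q] the set of [mS]. One-sided conditions [S] give the
    layer-cake formula, two-sided ones the layers of [layer_quotient]. *)
Lemma tonelli_wmeas (R : realType) (D B : set R) (v : R -> R) (S : R -> R -> Prop) :
  measurable (D : set (lebR R)) -> L0 D v -> (forall x, D x -> (0 <= v x)%R) ->
  measurable ([set z | [/\ D z.1, B z.2 & S z.1 z.2]] : set (lebR R * lebR R)) ->
  \int[leb R]_(s in B) wmeas v [set x | D x /\ S x s] =
  \int[leb R]_(x in D) ((v x)%:E * leb R [set s | B s /\ S x s]).
Proof.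
move=> mD mv v0 mS; set Q := [set z | _] in mS.
pose v' : lebR R -> R := v \_ D.
have v'0 x : (0 <= v' x)%R.
  by rewrite /v' patchE; case: ifPn => // /set_mem; exact: v0.
have mv' : measurable_fun setT v' by apply/(measurable_restrictT _ mD).
pose F (z : lebR R * lebR R) := (v' z.1 * \1_Q z)%:E.
have mF : measurable_fun setT F.
  apply/measurable_EFinP; apply: measurable_funM; last exact: measurable_indic.
  exact: (measurableT_comp mv' measurable_fst).
have F0 z : 0 <= F z by rewrite lee_fin mulr_ge0.
have := @fubini_tonelli _ _ _ _ _ (leb R) (leb R) F mF F0.
rewrite [X in X = _ -> _](_ : _ = \int[leb R]_(x in D) ((v x)%:E * leb R [set s | B s /\ S x s])); last first.
  rewrite [RHS]integral_mkcond; apply: eq_integral => x _; rewrite patchE.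
  case: ifPn => xD; last first.
    by apply: integral0_eq => y _; rewrite /F /= /v' patchE (negbTE xD) mul0r.
  pose A : set (lebR R) := [set s | B s /\ S x s].
  have mA : measurable A.
    rewrite (_ : A = xsection Q x); first exact: (@measurable_xsection _ _ (lebR R) (lebR R) Q x mS).
    apply/seteqP; split=> [s [Bs Ss]|s]; rewrite /xsection/= inE; last by case.
    by split => //; exact: set_mem.
  have mA1 : measurable_fun setT (fun s : lebR R => (\1_A s : R)%:E).
    by apply/measurable_EFinP; exact: (measurable_indic (U := A)).
  have -> : leb R [set s | B s /\ S x s] = \int[leb R]_s (\1_A s)%:E.
    by rewrite (integral_indic _ measurableT mA) setIT.
  rewrite -(ge0_integralZl (leb R) measurableT mA1); last 2 first.
  - by move=> y _; rewrite lee_fin.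
  - by rewrite lee_fin v0//; exact: set_mem.
  apply: eq_integral => y _; rewrite /F /= /v' patchE xD -EFinM; congr (_ * _)%:E.
  rewrite !indicE; suff -> : ((x, y) \in Q) = (y \in A) by [].
  by apply/idP/idP; rewrite !inE/= => -[]// ? ?; split => //; exact: set_mem.
move=> ->; rewrite [LHS]integral_mkcond; apply: eq_integral => s _; rewrite patchE.
case: ifPn => sB; last first.
  apply/esym/integral0_eq => x _; rewrite /F /= indicE.
  have /negbTE-> : (x, s) \notin Q; last by rewrite mulr0.
  by apply: contra sB; rewrite !inE => -[].
rewrite /wmeas integral_mkcond; apply: eq_integral => x _; rewrite /F /= patchE indicE /v' patchE.
have [xD|xD] := boolP (x \in D); last first.
  rewrite mul0r; case: ifPn => // /set_mem [/mem_set xD' _].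
  by rewrite xD' in xD.
rewrite (_ : (_ \in Q) = (x \in [set x | D x /\ S x s])); first by case: ifPn; rewrite ?mulr1 ?mulr0.
by apply/idP/idP; rewrite !inE/= => -[]// Dx Sx; split => //; exact: set_mem.
Qed.

Lemma measurable_superlevel_prod (R : realType) (D B : set R) (y z : R -> R -> \bar R) :
  measurable (D : set (lebR R)) -> measurable (B : set (lebR R)) ->
  measurable_fun (D `*` B : set (lebR R * lebR R)) (fun p => y p.1 p.2) ->
  measurable_fun (D `*` B : set (lebR R * lebR R)) (fun p => z p.1 p.2) ->
  measurable ([set p | [/\ D p.1, B p.2 & y p.1 p.2 < z p.1 p.2]] : set (lebR R * lebR R)).
Proof.
move=> mD mB my mz; have := measurable_lte (measurableX mD mB) my mz.
congr (measurable _); apply/seteqP; split=> p /=; first by move=> [[]].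
by case=> ? ? ?; split.
Qed.

Lemma measurable_fst_comp (R : realType) d (T : measurableType d) (D B : set R) (y : R -> T) :
  measurable (D : set (lebR R)) -> measurable_fun (D : set (lebR R)) (y : lebR R -> T) ->
  measurable_fun (D `*` B : set (lebR R * lebR R)) (fun p => y p.1).
Proof.
move=> mD my; apply: (measurable_comp mD _ my); first by move=> _ [p [pD _] <-].
by apply: measurable_funS (@measurable_fst _ _ _ _).
Qed.

Lemma measurable_snd_comp (R : realType) d (T : measurableType d) (D B : set R) (y : R -> T) :
  measurable (B : set (lebR R)) -> measurable_fun (B : set (lebR R)) (y : lebR R -> T) ->
  measurable_fun (D `*` B : set (lebR R * lebR R)) (fun p => y p.2).
Proof.
move=> mB my; apply: (measurable_comp mB _ my); first by move=> _ [p [_ pB] <-].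
by apply: measurable_funS (@measurable_snd _ _ _ _).
Qed.

Lemma leb_oitv_bnd (R : realType) (l : R) (y : \bar R) :
  leb R [set s | (l < s)%R /\ s%:E < y] = Order.max (y - l%:E) 0.
Proof.
rewrite lebE; case: y => [r| |].
- rewrite (_ : [set s | _] = `]l, r[%classic); last first.
    by apply/seteqP; split=> s; rewrite /= in_itv/= lte_fin => /andP.
  rewrite lebesgue_measure_itv/= lte_fin -EFinB maxEge lee_fin subr_ge0.
  by case: ltgtP => // ->; rewrite subrr.
- rewrite (_ : [set s | _] = `]l, +oo[%classic); last first.
    by apply/seteqP; split=> s; rewrite /= in_itv/= andbT ?ltry// => -[].
  by rewrite lebesgue_measure_itv/= ltry/=; apply/esym/max_idPl; rewrite leey.
- rewrite (_ : [set s | _] = set0) ?measure0; first by apply/esym/max_idPr; rewrite leNye.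
  by apply/seteqP; split=> s //= [_]; rewrite ltNge leNye.
Qed.

Lemma layer_cake (R : realType) (D : set R) (y : R -> \bar R) :
  measurable (D : set (lebR R)) -> measurable_fun (D : set (lebR R)) (y : lebR R -> _) ->
  (forall x, D x -> 0 <= y x) ->
  \int[leb R]_(x in D) y x =
  \int[leb R]_(s in oint +oo) leb R [set x | D x /\ s%:E < y x].
Proof.
move=> mD my y0; have mO := borel_leb (measurable_oint +oo : measurable (oint (+oo : \bar R))).
have := @tonelli_wmeas R D (oint +oo) (cst 1%R) (fun x s => s%:E < y x) mD.
move=> /(_ (@measurable_cst _ _ _ _ _ _) (fun _ _ => ler01)) T1.
rewrite [RHS](eq_integral (fun s : lebR R => wmeas (cst 1%R) [set x | D x /\ s%:E < y x])); last first.
  move=> s _; rewrite /wmeas /= integral_cst ?mul1e//.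
  exact: emeasurable_fun_o_infty.
rewrite T1; last first.
  apply: (@measurable_superlevel_prod R D (oint +oo) (fun _ s : R => s%:E) (fun x _ : R => y x)) => //.
    apply: (@measurable_snd_comp R _ _ _ _ EFin) => //.
    by apply/measurable_EFinP; exact: measurable_id_leb.
  exact: measurable_fst_comp.
apply: eq_integral => x /set_mem Dx; rewrite mul1e.
rewrite (_ : [set s | _] = [set s | (0 < s)%R /\ s%:E < y x]).
  by rewrite leb_oitv_bnd sube0; apply/esym/max_idPl; exact: y0.
by apply/seteqP; split=> s /=; rewrite /oint /= ltry; [case=> -[]|case].
Qed.

(** Inversion is x |x|^-2, a product of measurable functions; at x = 0 both sides are 0. *)
Lemma measurable_inv (R : realType) :
  measurable_fun [set: R] (fun x : R => x^-1)%R.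
Proof.
have -> : (fun x : R => x^-1)%R = (fun x => x * (`|x| `^ (-1) * `|x| `^ (-1)))%R.
  apply/funext => x; rewrite powR_inv1// -invfM -normrM ger0_norm -?expr2 ?sqr_ge0//.
  have [->|x0] := eqVneq x 0%R; first by rewrite mul0r invr0.
  by rewrite expr2 invfM mulrA divff// mul1r.
have mp : measurable_fun [set: R] (fun x : R => `|x| `^ (-1))%R.
  exact: (measurableT_comp (@measurable_powR R (-1)%R) (@normr_measurable R setT)).
by apply: measurable_funM => //; exact: measurable_funM.
Qed.

Lemma L0_quot (R : realType) (D : set R) (f v : R -> R) :
  L0 D f -> L0 D v -> L0 D (quot f v).
Proof.
move=> mf mv.
exact: (measurable_funM mf (measurableT_comp (@measurable_inv R) mv)).
Qed.

Lemma measurable_layer_prod (R : realType) (D : set R) (v : R -> R) (y : R -> \bar R) (l : R) :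
  measurable (D : set (lebR R)) -> L0 D v ->
  measurable_fun (D : set (lebR R)) (y : lebR R -> _) ->
  measurable ([set p | [/\ D p.1, oint +oo p.2 & (l * v p.1)%:E <= p.2%:E < y p.1]]
    : set (lebR R * lebR R)).
Proof.
move=> mD mv my.
have mO := borel_leb (measurable_oint +oo : measurable (oint (+oo : \bar R))).
have mid E : measurable_fun (E : set (lebR R)) (EFin : lebR R -> _).
  by apply/measurable_EFinP; exact: measurable_id_leb.
have mlv : measurable_fun (D : set (lebR R)) (fun x => (l * v x)%:E).
  by apply/measurable_EFinP; exact: measurable_funM.
have m1 : measurable ([set p | [/\ D p.1, oint +oo p.2 & (l * v p.1)%:E <= p.2%:E]]
    : set (lebR R * lebR R)).
  have := @measurable_lee _ _ _ _ (measurableX mD mO) (fun p => (l * v p.1)%:E) (fun p => p.2%:E).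
  move=> /(_ (@measurable_fst_comp R _ _ D (oint +oo) (fun x => (l * v x)%:E) mD mlv)).
  move=> /(_ (@measurable_snd_comp R _ _ _ _ EFin mO (mid _))).
  congr (measurable _); apply/seteqP; split=> p /=; first by move=> [[]].
  by case=> ? ? ?; split.
have m2 := @measurable_superlevel_prod R D (oint +oo) (fun _ s : R => s%:E)
  (fun x _ : R => y x) mD mO (@measurable_snd_comp R _ _ _ _ EFin mO (mid _))
  (@measurable_fst_comp R _ _ D (oint +oo) y mD my).
have := measurableI _ _ m1 m2; congr (measurable _).
apply/seteqP; split=> p /=; first by case=> -[? ? lu] [_ _ uy]; split => //; apply/andP.
by case=> ? ? /andP[].
Qed.

Lemma measurable_leb_layer (R : realType) (D : set R) (v : R -> R) (y : R -> \bar R) (l : R) :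
  measurable (D : set (lebR R)) -> L0 D v ->
  measurable_fun (D : set (lebR R)) (y : lebR R -> _) ->
  measurable_fun (oint +oo : set (lebR R))
    (fun u => leb R [set x | D x /\ (l * v x)%:E <= u%:E < y x]).
Proof.
move=> mD mv my; have mP := measurable_layer_prod l mD mv my.
have mO := borel_leb (measurable_oint +oo : measurable (oint (+oo : \bar R))).
have mY := measurable_fun_ysection (leb R) mP.
have mY' : measurable_fun (oint +oo : set (lebR R)) _ := measurable_funS measurableT (@subsetT _ _) mY.
apply: eq_measurable_fun mY' => u /set_mem u0 /=; congr (leb R _).
apply/seteqP; split=> x; rewrite /ysection/= inE; first by case.
by case.
Qed.

(** Both sides are the integral of (y - l v)^+: on the left Tonelli produces v (y/v - l)^+, on the
    right the length of the interval from l v to y. Where v = 0 the left integrand vanishes while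
    the right one is y, whence the condition on [y]. *)
Lemma layer_quotient (R : realType) (D : set R) (v : R -> R) (y : R -> \bar R) (l : R) :
  measurable (D : set (lebR R)) -> L0 D v -> (forall x, D x -> (0 <= v x)%R) ->
  measurable_fun (D : set (lebR R)) (y : lebR R -> _) ->
  (forall x, D x -> 0 <= y x) -> (0 <= l)%R ->
  {ae leb R, forall x, D x -> v x = 0%R -> y x = 0} ->
  \int[leb R]_(s in [set s | (l < s)%R])
     wmeas v [set x | D x /\ s%:E < y x * (v x)^-1%:E] =
  \int[leb R]_(u in oint +oo)
     leb R [set x | D x /\ (l * v x)%:E <= u%:E < y x].
Proof.
move=> mD mv v0 my y0 l0 vy0.
have mB : measurable ([set s | (l < s)%R] : set (lebR R)).
  have := itv_leb `]l, +oo[; congr (measurable _).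
  by apply/seteqP; split=> s; rewrite /= in_itv/= andbT.
have mv1 : measurable_fun (D : set (lebR R)) (fun x => (v x)^-1%:E).
  by apply/measurable_EFinP; exact: (measurableT_comp (@measurable_inv R) mv).
have myv : measurable_fun (D : set (lebR R)) (fun x => y x * (v x)^-1%:E).
  exact: emeasurable_funM.
have mlv : measurable_fun (D : set (lebR R)) (fun x => (l * v x)%:E).
  by apply/measurable_EFinP; exact: measurable_funM.
have mid E : measurable_fun (E : set (lebR R)) (EFin : lebR R -> _).
  by apply/measurable_EFinP; exact: measurable_id_leb.
rewrite (@tonelli_wmeas R D _ v (fun x s => s%:E < y x * (v x)^-1%:E) mD mv v0); last first.
  exact: (@measurable_superlevel_prod R D _ (fun _ s : R => s%:E)
    (fun x _ : R => y x * (v x)^-1%:E) mD mB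
    (@measurable_snd_comp R _ _ _ _ EFin mB (mid _))
    (@measurable_fst_comp R _ _ D [set s | (l < s)%R] (fun x : R => y x * (v x)^-1%:E) mD myv)).
have mce (E : set R) (c : \bar R) :
    measurable_fun (E : set (lebR R)) (cst c : lebR R -> \bar R).
  exact: measurable_cst.
pose S x u := (l * v x)%:E <= u%:E < y x.
have mS u : measurable ([set x | D x /\ S x u] : set (lebR R)).
  have m1 := measurable_lee mD mlv (mce D u%:E).
  have m2 := measurable_lte mD (mce D u%:E) my.
  have := measurableI _ _ m1 m2; congr (measurable _).
  by apply/seteqP; split=> x /=; [case=> -[Dx h] [_ h']; split => //; apply/andP|move=> [Dx /andP[]]].
rewrite [RHS](eq_integral (fun u : lebR R => wmeas (cst 1%R) [set x | D x /\ S x u])); last first.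
  by move=> u _; rewrite /wmeas /= integral_cst ?mul1e//; exact: mS.
have mc1 : L0 D (cst 1%R : R -> R) by exact: measurable_cst.
rewrite (@tonelli_wmeas R D _ _ S mD mc1 (fun _ _ => ler01)); last first.
  exact: (measurable_layer_prod l mD mv my).
transitivity (\int[leb R]_(x in D)
    ((v x)%:E * Order.max (y x * (v x)^-1%:E - l%:E) 0)).
  by apply: eq_integral => x _; rewrite -leb_oitv_bnd.
transitivity (\int[leb R]_(x in D) Order.max (y x - (l * v x)%:E) 0); last first.
  apply: eq_integral => x /set_mem Dx; rewrite mul1e -leb_oitv_bnd.
  (* The layer contains its lower endpoint, so as to be a difference of strict superlevel sets; that
     point is null. *)
  apply: (@leb_ae_eq _ _ _ [set (l * v x)%R]).
  - apply/(negligibleP (leb R)); last exact: leb_set1.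
    have := itv_leb `[(l * v x)%R, (l * v x)%R]; congr (measurable _).
    by rewrite set_itv1.
  - have m1 : measurable ([set s | (l * v x < s)%R] : set (lebR R)).
      have := itv_leb `](l * v x)%R, +oo[; congr (measurable _).
      by apply/seteqP; split=> s; rewrite /= in_itv/= andbT.
    have := measurable_lte m1 (mid _) (mce _ (y x)).
    by congr (measurable _).
  - move=> u /= ulv; rewrite /S /oint/= ltry lee_fin; split.
      move=> [lu uy]; rewrite uy (ltW lu); split => //; split => //.
      by apply: le_lt_trans lu; rewrite mulr_ge0// v0.
    case=> [[u0 _] /andP[lu uy]]; split => //; rewrite lt_neqAle lu andbT.
    by apply/eqP => /esym.
have mv' : measurable_fun (D : set (lebR R)) (EFin \o v) by exact/measurable_EFinP.
have m1 : measurable_fun (D : set (lebR R))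
    (fun x => (v x)%:E * Order.max (y x * (v x)^-1%:E - l%:E) 0).
  exact: (emeasurable_funM mv'
    (measurable_maxe (emeasurable_funB myv (mce D l%:E)) (mce D 0))).
have m2 : measurable_fun (D : set (lebR R)) (fun x => Order.max (y x - (l * v x)%:E) 0).
  exact: (measurable_maxe (emeasurable_funB my mlv) (mce D 0)).
apply: (ge0_ae_eq_integral mD m1 m2).
- by move=> x Dx; rewrite mule_ge0 ?lee_fin ?v0// le_max lexx orbT.
- by move=> x Dx; rewrite le_max lexx orbT.
apply: ae_leb_mono vy0 => x vy Dx.
have [vx0|vx0] := eqVneq (v x) 0%R.
  by rewrite vx0 (vy Dx vx0) mulr0 mul0e sube0 maxxx.
have vp : (0 < v x)%R by rewrite lt_neqAle eq_sym vx0 v0.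
have -> : y x - (l * v x)%:E = (v x)%:E * (y x * (v x)^-1%:E - l%:E).
  have := y0 _ Dx; case: (y x) => [r _| _|//].
    change ((r - l * v x)%:E = (v x * (r * (v x)^-1 - l))%:E); congr EFin.
    by rewrite mulrBr mulrCA divff// mulr1 (mulrC l).
  by rewrite gt0_mulye ?lte_fin ?invr_gt0//= gt0_muley// lte_fin.
by rewrite maxe_pMr ?mule0// lee_fin ltW.
Qed.

(** * Weighted measures and transport to Lebesgue measure by ranks *)

(** [wmeas v] is a bare set function and [v] is arbitrary outside [D]; extending [v] by 0 yields a
    bundled measure to which the results on measures apply. *)
Lemma wmeas_measure (R : realType) (D : set R) (v : R -> R) :
  measurable (D : set (lebR R)) -> L0 D v -> (forall x, D x -> (0 <= v x)%R) ->
  exists mu : {measure set (lebR R) -> \bar R},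
    forall A, measurable (A : set (lebR R)) -> mu A = wmeas v (A `&` D).
Proof.
move=> mD mv v0; pose g : lebR R -> \bar R := (EFin \o v) \_ D.
have g0 x : 0 <= g x.
  by rewrite /g patchE; case: ifPn => // /set_mem /v0; rewrite lee_fin.
have mg : measurable_fun setT g.
  by apply/(measurable_restrictT _ mD); exact/measurable_EFinP.
pose nu (A : set (lebR R)) := \int[leb R]_(x in A) g x.
have nu0 : nu set0 = 0 by rewrite /nu integral_set0.
have nu_ge0 A : 0 <= nu A by apply: integral_ge0.
have nuS := @semi_sigma_additive_nng_induced _ _ _ (leb R) _ mg g0.
pose M := isMeasure.Build _ _ _ nu nu0 nu_ge0 nuS.
pose N : {measure set (lebR R) -> \bar R} := HB.pack nu M.
by exists N => A mA; rewrite /wmeas integral_mkcondr.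
Qed.

Lemma distr_wmeas (R : realType) (D : set R) (v : R -> R)
    (mu : {measure set (lebR R) -> \bar R}) (f : R -> \bar R) (s : R) :
  measurable (D : set (lebR R)) ->
  (forall A, measurable (A : set (lebR R)) -> mu A = wmeas v (A `&` D)) ->
  measurable_fun (D : set (lebR R)) f ->
  distr (wmeas v) D f s = distr mu D f s.
Proof.
move=> mD muE mf; rewrite /distr muE; last exact: measurable_distr_set.
by congr (wmeas v _); apply/seteqP; split=> x //=; [case|case=> -[]].
Qed.

(** Uniqueness of measures: the image of [mu] on [F] under [f] and Lebesgue measure on [oint L]
    agree on the rays ]-oo, r[, which are stable under intersection and generate the Borel sets. *)
Lemma measure_oint_eq (R : realType) (mu : {measure set (lebR R) -> \bar R})
    (D F : set R) (f : R -> R) (L : \bar R) :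
  measurable (F : set (lebR R)) -> L0 F f -> 0 <= L -> mu F <= L ->
  (forall x, F x -> (0 <= f x)%R) ->
  (forall t, oint L t -> mu [set x | F x /\ (f x < t)%R] = t%:E) ->
  forall C : set R, measurable (C : set (measurableTypeR R)) ->
  mu [set x | F x /\ C (f x)] = leb R (C `&` oint L).
Proof.
move=> mF mf Lge0 muF f0 ft C mC.
pose f' : lebR R -> measurableTypeR R := f \_ F.
have mf' : measurable_fun setT f' by apply/(measurable_restrictT _ mF).
pose m0 : {measure set (lebR R) -> \bar R} := mrestr mu mF.
pose m1 := measure_function_pushforward__canonical__measure_function_Measure m0 mf'.
pose m2 : {measure set (measurableTypeR R) -> \bar R} :=
  mrestr (@lebesgue_measure R) (measurable_oint L).
have m1E A : m1 A = mu [set x | F x /\ A (f x)].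
  rewrite /m1 /= /pushforward /m0 /= /mrestr; congr (mu _).
  apply/seteqP; split=> x /=; rewrite /f' patchE.
    by move=> [+ Fx]; rewrite mem_set.
  by move=> [Fx]; rewrite mem_set.
have mray r : measurable ([set x | F x /\ (f x < r)%R] : set (lebR R)).
  have mcr : L0 F (cst r) by exact: measurable_cst.
  by have := measurable_fun_ltr mf mcr => /(_ mF [set true] I).
have ray r : mu [set x | F x /\ (f x < r)%R] = leb R (`]-oo, r[%classic `&` oint L).
  have [r0|r0] := leP r 0%R.
    rewrite [X in mu X](_ : _ = set0); last first.
      by apply/seteqP; split=> x //= [/f0 + /lt_le_trans/(_ r0)]; rewrite leNgt => /negP.
    rewrite [X in leb _ X](_ : _ = set0) ?measure0//.
    by apply/seteqP; split=> x //= []; rewrite in_itv/= => /lt_le_trans/(_ r0) /lt_trans h [/h]; rewrite ltxx.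
  have -> : `]-oo, r[%classic `&` oint L = oint (Order.min r%:E L).
    rewrite -ointI; apply/seteqP; split=> x /=.
      by rewrite in_itv/= => -[xr [x0 xL]]; split; split.
    by rewrite in_itv/= => -[[x0 xr] [_ xL]]; split => //; split.
  rewrite leb_oint; last by rewrite le_min Lge0 lee_fin ltW.
  have [rL|Lr] := ltP r%:E L; first by rewrite ft//.
  apply/eqP; rewrite eq_le; apply/andP; split.
    by apply: le_trans muF; apply: le_measure; rewrite ?inE// => x [].
  (* The hypothesis covers only t < L. If the mass fell short of L, a number t strictly between the
     two would be the mass of a smaller sublevel set. *)
  rewrite leNgt; apply/negP => muL.
  have mE : mu [set x | F x /\ (f x < r)%R] \is a fin_num.
    by rewrite ge0_fin_numE// (lt_le_trans muL) ?leey.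
  have LE : L \is a fin_num by rewrite ge0_fin_numE// (le_lt_trans Lr) ?ltry.
  move: muL; rewrite -(fineK mE) -(fineK LE) lte_fin => /midf_lt[].
  set m := (_ / _)%R => m1' m2'.
  have : m%:E <= mu [set x | F x /\ (f x < r)%R].
    rewrite -(ft m); last first.
      by split; [apply: le_lt_trans m1'; rewrite fine_ge0|rewrite -(fineK LE) lte_fin].
    apply: le_measure; rewrite ?inE// => x [Fx fx]; split => //; apply: lt_le_trans fx _.
    by rewrite -lee_fin (le_trans _ Lr)// -(fineK LE) lee_fin ltW.
  by rewrite -(fineK mE) lee_fin leNgt m1'.
rewrite -m1E; transitivity (m2 C); last by [].
pose g (k : nat) : set (measurableTypeR R) := `]-oo, k%:R[%classic.
refine (@measure_unique _ R (measurableTypeR R) (@RGenInftyO.G R) g _ _ _ _ m1 m2 _ _ C mC).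
- exact: RGenInftyO.measurableE.
- move=> _ _ [x ->] [y ->]; exists (Order.min x y).
  apply/seteqP; split=> z /=; rewrite !in_itv/= lt_min; first by case=> -> ->.
  by move=> /andP[-> ->].
- by move=> k; exists k%:R.
- apply/seteqP; split=> // x _; exists (Num.bound `|x|) => //=.
  by rewrite /g/= in_itv/= (le_lt_trans (ler_norm x))// archi_boundP.
- by move=> _ [r ->]; rewrite m1E; apply: (etrans _ (ray r)); congr (mu _); apply/seteqP; split=> x /=; rewrite ?in_itv.
- move=> k; rewrite m1E /g (_ : [set x | _] = [set x | F x /\ (f x < k%:R)%R]); last first.
    by apply/seteqP; split=> x /=; rewrite ?in_itv.
  rewrite ray; apply: (@le_lt_trans _ _ (leb R (oint k%:R%:E))); last first.
    by rewrite leb_oint ?lee_fin// ltry.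
  apply: le_measure; rewrite ?inE; [|exact: borel_leb (measurable_oint _)|].
    by apply: measurableI; [exact: itv_leb|exact: borel_leb (measurable_oint _)].
  by move=> x [/= + [x0 _]]; rewrite in_itv/=.
Qed.

(** Unlike in [distr] no absolute value is taken, because the ranking functions also take negative
    values. *)
Definition superdistr (R : realType) (mu : set R -> \bar R) (D : set R)
  (q : R -> R) (c : R) : \bar R := mu [set x | D x /\ (c < q x)%R].

Lemma measurable_superdistr_set (R : realType) (D : set R) (q : R -> R) (c : R) :
  measurable (D : set (lebR R)) -> L0 D q ->
  measurable ([set x | D x /\ (c < q x)%R] : set (lebR R)).
Proof.
move=> mD mq; have mc : L0 D (cst c) by exact: measurable_cst.
by have := measurable_fun_ltr mc mq => /(_ mD [set true] I).
Qed.

Lemma le_superdistr (R : realType) (mu : {measure set (lebR R) -> \bar R})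
    (D : set R) (q : R -> R) (c c' : R) :
  measurable (D : set (lebR R)) -> L0 D q ->
  (c <= c')%R -> superdistr mu D q c' <= superdistr mu D q c.
Proof.
move=> mD mq cc'; apply: le_measure; rewrite ?inE; try exact: measurable_superdistr_set.
by move=> x [Dx]; split => //; exact: le_lt_trans cc' _.
Qed.

Lemma measurable_superdistr (R : realType) (mu : {measure set (lebR R) -> \bar R})
    (D : set R) (q : R -> R) :
  measurable (D : set (lebR R)) -> L0 D q ->
  measurable_fun (D : set (lebR R)) (superdistr mu D q \o q).
Proof.
move=> mD mq; apply: (@borel_comp_leb _ _ _ D setT q) => //.
by apply: nonincreasing_emeasurable => // s t _ _; exact: le_superdistr.
Qed.

(* The rank [x |-> d (q x)] of a point in the decreasing order of [q] transports
   [mu] to Lebesgue measure. It is used for [mu = leb], where it replaces Ryff's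
   measure-preserving map, and for [mu = v dm], [q = -id], where it is [V]. *)
Section rank_transport.
Context (R : realType) (mu : {measure set (lebR R) -> \bar R}) (D : set R) (q : R -> R).
Hypotheses (mD : measurable (D : set (lebR R))) (mq : L0 D q).
Hypothesis q_level0 : forall c, mu [set x | D x /\ q x = c] = 0.
Hypothesis d_bounded : forall t, oint (mu D) t ->
  exists c, t%:E <= superdistr mu D q c < +oo.
Hypothesis d_small : forall t, oint (mu D) t -> exists c, superdistr mu D q c < t%:E.
Local Notation d := (superdistr mu D q).

Let superdistrE c : d c = mu [set x | D x /\ (c <= q x)%R].
Proof.
have m1 := measurable_superdistr_set c mD mq.
have m2 : measurable ([set x | D x /\ q x = c] : set (lebR R)).
  have mc : L0 D (cst c) by exact: measurable_cst.
  have := measurable_fun_eqr mq mc => /(_ mD [set true] I).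
  by congr (measurable _); apply/seteqP; split=> x /= [? /eqP].
have -> : [set x | D x /\ (c <= q x)%R] =
    [set x | D x /\ (c < q x)%R] `|` [set x | D x /\ q x = c].
  apply/seteqP; split=> x /=.
    by rewrite le_eqVlt => -[Dx /orP[/eqP->|]]; [right|left].
  by case=> [[Dx /ltW]|[Dx ->]]; split.
rewrite measureU//; first by rewrite [X in _ = _ + X](q_level0 c) adde0.
by apply/seteqP; split=> x //= [[_ +] [_ qx]]; rewrite qx ltxx.
Qed.

(** The level is the infimum of those where d < t. Right continuity of d gives d <= t there, and
    left continuity, which comes from null level sets and finiteness at [c1], gives d >= t. *)
Lemma rank_cut t : oint (mu D) t -> exists c0,
  [/\ d c0 = t%:E, forall c, (c0 < c)%R -> d c < t%:E &
      forall c, d c < t%:E -> (c0 <= c)%R].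
Proof.
move=> Dt; have [c1 /andP[tc1 c1oo]] := d_bounded Dt; have [c2 c2t] := d_small Dt.
pose C := [set c | d c < t%:E].
have lbC : lbound C c1.
  move=> c /= ct; rewrite leNgt; apply/negP => cc1.
  have := le_lt_trans (le_superdistr mu mD mq (ltW cc1)) ct.
  by rewrite ltNge tc1.
have Clb : has_lbound C by exists c1.
have C0 : C !=set0 by exists c2.
have c1c0 : (c1 <= inf C)%R by apply: lb_le_inf.
have Cup c : (inf C < c)%R -> C c.
  move=> /(inf_lt C0)[c' Cc' c'c]; apply: le_lt_trans Cc'.
  by apply: le_superdistr => //; exact: ltW.
exists (inf C); split=> //; last by move=> c Cc; exact: ge_inf.
apply/eqP; rewrite eq_le; apply/andP; split.
  rewrite leNgt; apply/negP => tc0.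
  have mq' : measurable_fun (D : set (lebR R)) (EFin \o q) by exact/measurable_EFinP.
  have [c' c0c' tc'] := superlevel_right (mD : measurable (D : set (lebR R))) mq' tc0.
  by have := lt_trans (Cup _ c0c') tc'; rewrite ltxx.
rewrite leNgt; apply/negP => c0t.
(* Continuity from above needs room to the left of [inf C] inside the region where d is finite. *)
have c10 : (c1 < inf C)%R.
  rewrite lt_neqAle c1c0 andbT; apply/eqP => e.
  by move: c0t; rewrite -e ltNge tc1.
have := c0t; rewrite superdistrE => c0t'.
have [c' /andP[c1c' c'c0] Cc'] := superlevel_left mD mq c10 c1oo c0t'.
by have := ge_inf Clb Cc'; rewrite leNgt c'c0.
Qed.

(** The set lies between {c0 < q} and {c0 <= q}, which both have measure t. *)
Lemma rank_sublevel t : oint (mu D) t -> mu [set x | D x /\ d (q x) < t%:E] = t%:E.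
Proof.
move=> Dt; have [c0 [dc0 Cup Cge]] := rank_cut Dt.
have mC : measurable ([set x | D x /\ d (q x) < t%:E] : set (lebR R)).
  exact: (emeasurable_fun_infty_o mD (measurable_superdistr mu mD mq)).
rewrite -[RHS]dc0; apply/eqP; rewrite eq_le; apply/andP; split.
  have mc : L0 D (cst c0) by exact: measurable_cst.
  rewrite superdistrE; apply: le_measure; rewrite ?inE; first exact: mC.
    by have := measurable_fun_ler mc mq => /(_ mD [set true] I).
  by move=> x [Dx xt]; split => //; exact: Cge.
apply: le_measure; rewrite ?inE; [exact: measurable_superdistr_set|exact: mC|].
by move=> x [Dx /Cup].
Qed.

(** Points of infinite rank may form a set of positive measure and are left out; those of finite
    rank already fill [oint (mu D)]. *)
Lemma rank_transport C : measurable (C : set (measurableTypeR R)) ->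
  mu [set x | [/\ D x, d (q x) < +oo & C (fine (d (q x)))]] = leb R (C `&` oint (mu D)).
Proof.
move=> mC; pose F := [set x | D x /\ d (q x) < +oo].
have md := measurable_superdistr mu mD mq.
have mF : measurable (F : set (lebR R)) by exact: (emeasurable_fun_infty_o mD md).
have d0 c : 0 <= d c by exact: measure_ge0.
have dfin x : F x -> d (q x) = (fine (d (q x)))%:E.
  by move=> [Dx dx]; rewrite fineK// ge0_fin_numE.
rewrite -(@measure_oint_eq R mu D F (fun x => fine (d (q x)))) //.
- by congr (mu _); apply/seteqP; split=> x /=; [case=> ? ? ?; split|case=> -[? ?]].
- rewrite /L0; have mdF : measurable_fun (F : set (lebR R)) (superdistr mu D q \o q).
    by apply: measurable_funS md => // x [].
  exact: (measurableT_comp (@fine_measurable R setT measurableT) mdF).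
- by apply: le_measure; rewrite ?inE// => x [].
- by move=> x _; apply: fine_ge0.
- move=> t Dt; rewrite -(rank_sublevel Dt); congr (mu _); apply/seteqP; split=> x /=.
    by move=> [Fx]; rewrite [in X in _ -> _ /\ X]dfin// lte_fin; split => //; case: Fx.
  move=> [Dx dt]; have Fx : F x by split => //; rewrite (lt_trans dt)// ltry.
  by split => //; rewrite -lte_fin -dfin.
Qed.

End rank_transport.

(** * Weights equimeasurable with a decreasing weight *)

Lemma nonincreasing_measurable_fun (R : realType) (D : set R) (w : R -> R) :
  is_interval D -> (forall s t, D s -> D t -> (s <= t)%R -> (w t <= w s)%R) ->
  measurable_fun (D : set (measurableTypeR R)) w.
Proof.
by move=> iD ndw; apply/measurable_EFinP; apply: nonincreasing_emeasurable.
Qed.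

Lemma distr_leb_le (R : realType) (a : \bar R) (f : R -> \bar R) (s : R) :
  0 <= a -> measurable_fun (oint a : set (lebR R)) f ->
  distr (leb R) (oint a) f s <= a.
Proof.
move=> a0 mf; rewrite -[leRHS](leb_oint a0).
have mI := borel_leb (measurable_oint a).
apply: le_measure; rewrite ?inE; [exact: measurable_distr_set|exact: mI|by move=> x []].
Qed.

Section weight.
Context (R : realType) (a : \bar R) (w : R -> R).
Hypothesis a0 : 0 < a.
Hypothesis w_gt0 : forall t, oint a t -> (0 < w t)%R.
Hypothesis ndw : forall s t, oint a s -> oint a t -> (s <= t)%R -> (w t <= w s)%R.
Local Notation I := (oint a).
Local Notation m := (leb R).

Let mIb : measurable (I : set (measurableTypeR R)) := measurable_oint a.
Let mI : measurable (I : set (lebR R)) := borel_leb (measurable_oint a).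

Lemma weight_measurable : measurable_fun (I : set (measurableTypeR R)) w.
Proof. exact: nonincreasing_measurable_fun (@is_interval_oint R a) ndw. Qed.

Lemma weight_L0 : L0 I w.
Proof. exact: borel_fun_leb mIb weight_measurable. Qed.

(** The rearrangement is right continuous and [w] need not be, so equality is only a.e.; the
    exceptions are among the values of the distribution function of [w] at rationals. *)
Lemma rearr_weight :
  {ae m, forall t, I t -> rearr m I (EFin \o w) t = (w t)%:E}.
Proof.
have mw : measurable_fun (I : set (lebR R)) (EFin \o w).
  by apply/measurable_EFinP; exact: weight_L0.
have cN := @countable_distr_rat R m I (EFin \o w).
apply: (ae_leb_countable cN) => t nt It; apply/eqP; rewrite eq_le; apply/andP; split.
  apply: rearr_le; first exact: w_gt0.
  rewrite -[leRHS]leb_oint ?lee_fin; last by case: It => /ltW.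
  have mot := borel_leb (measurable_oint t%:E).
  apply: le_measure; rewrite ?inE; [exact: measurable_distr_set|exact: mot|].
  move=> x [Ix wx]; split; first by case: Ix.
  rewrite lte_fin ltNge; apply/negP => tx; move: wx.
  by rewrite /= lte_fin ger0_norm ?ltNge ?ndw// ltW// w_gt0.
apply: (rearr_ge mI mw); first by move=> q tq; apply: nt; exists q.
move=> s /andP[s0 sw]; rewrite -[leLHS]leb_oint ?lee_fin; last by case: It => /ltW.
have mot := borel_leb (measurable_oint t%:E).
apply: le_measure; rewrite ?inE; [exact: mot|exact: measurable_distr_set|].
move=> x [x0 xt]; have Ix : I x.
  by split => //; apply: lt_trans xt _; case: It.
split => //=; rewrite lte_fin (lt_le_trans sw)//.
by rewrite ger0_norm ?(ltW (w_gt0 _))// ndw// -lee_fin ltW.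
Qed.

Section equimeasurable.
Variable v : R -> R.
Hypothesis mv : L0 I v.
Hypothesis v_ge0 : forall x, I x -> (0 <= v x)%R.
Hypothesis vw : {ae m, forall t, I t -> rearr m I (EFin \o v) t = (w t)%:E}.

Lemma equimeasurable_weight s : (0 <= s)%R ->
  m [set x | I x /\ (s < v x)%R] = m [set x | I x /\ (s < w x)%R].
Proof.
move=> s0; have mEv : measurable_fun (I : set (lebR R)) (EFin \o v) by exact/measurable_EFinP.
have -> : m [set x | I x /\ (s < v x)%R] = distr m I (EFin \o v) s.
  congr (m _); apply/seteqP; split=> x /= [Ix]; rewrite lte_fin ger0_norm ?v_ge0//.
have E := leb_rearr_gt m mI mEv s0 (ltW a0).
rewrite (min_idPl (distr_leb_le s (ltW a0) mEv)) in E.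
rewrite -E; apply: (leb_ae_eq (iffLR (ae_lebP _) vw)).
  apply: (emeasurable_fun_o_infty mI).
  exact: measurable_rearr_leb mIb.
move=> t /contrapT h; split=> -[It]; split => //; last by rewrite h.
by rewrite -lte_fin -h.
Qed.

Lemma wmeas_equimeasurable : wmeas v I = wmeas w I.
Proof.
have mEv : measurable_fun (I : set (lebR R)) (EFin \o v) by exact/measurable_EFinP.
have mEw : measurable_fun (I : set (lebR R)) (EFin \o w).
  by apply/measurable_EFinP; exact: weight_L0.
rewrite /wmeas (layer_cake mI mEv); last by move=> x Ix; rewrite lee_fin v_ge0.
rewrite (layer_cake mI mEw); last by move=> x Ix; rewrite lee_fin ltW// w_gt0.
apply: eq_integral => s /set_mem[s0 _].
exact: equimeasurable_weight (ltW s0).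
Qed.

(** Compare layer by layer. If s < w x, then {w > s} contains (0, x), and the part of {v > s} in (0,
    x) is no larger. Otherwise {w > s} lies in (0, x) and has the measure of the whole of {v >
    s}. *)
Lemma primitive_equimeasurable_le x : I x -> primitive v x <= primitive w x.
Proof.
move=> Ix; have x0 : 0 <= x%:E by case: Ix => /ltW.
have mx := borel_leb (measurable_oint x%:E).
have xI : oint x%:E `<=` I by apply: le_oint; case: Ix => _ /ltW.
have mEv : measurable_fun (oint x%:E : set (lebR R)) (EFin \o v).
  by apply/measurable_EFinP; apply: measurable_funS mv.
have mEw : measurable_fun (oint x%:E : set (lebR R)) (EFin \o w).
  by apply/measurable_EFinP; apply: measurable_funS weight_L0.
rewrite /primitive (layer_cake mx mEv); last by move=> y /xI Iy; rewrite lee_fin v_ge0.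
rewrite (layer_cake mx mEw); last by move=> y /xI Iy; rewrite lee_fin ltW// w_gt0.
have mO := borel_leb (measurable_oint (+oo : \bar R)).
have mlev (g : R -> R) : L0 I g -> measurable_fun (oint +oo : set (lebR R))
    (fun s => m [set y | oint x%:E y /\ s%:E < (EFin \o g) y]).
  move=> mg; have mgs s : measurable ([set y | oint x%:E y /\ s%:E < (EFin \o g) y] : set (lebR R)).
    apply: (emeasurable_fun_o_infty mx); apply/measurable_EFinP.
    exact: measurable_funS mg.
  apply: (borel_fun_leb (measurable_oint +oo)).
  apply: nonincreasing_emeasurable; first exact: is_interval_oint.
  move=> s t _ _ st; apply: le_measure; rewrite ?inE; try exact: mgs.
  by move=> y [xy]; split => //; apply: le_lt_trans b; rewrite lee_fin.
apply: (ge0_le_integral m mO (fun _ _ => measure_ge0 _ _)); [exact: (mlev _ mv)|exact: (mlev _ weight_L0)|].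
move=> s [s0 _].
have mEvI : measurable_fun (I : set (lebR R)) (EFin \o v) by exact/measurable_EFinP.
have mEwI : measurable_fun (I : set (lebR R)) (EFin \o w).
  by apply/measurable_EFinP; exact: weight_L0.
have mvs : measurable ([set y | I y /\ (s < v y)%R] : set (lebR R)).
  exact: (emeasurable_fun_o_infty mI mEvI s%:E).
have mws : measurable ([set y | I y /\ (s < w y)%R] : set (lebR R)).
  exact: (emeasurable_fun_o_infty mI mEwI s%:E).
have mvx : measurable ([set y | oint x%:E y /\ s%:E < (EFin \o v) y] : set (lebR R)).
  exact: (emeasurable_fun_o_infty mx mEv).
have mwx : measurable ([set y | oint x%:E y /\ s%:E < (EFin \o w) y] : set (lebR R)).
  exact: (emeasurable_fun_o_infty mx mEw).
have [swx|wxs] := ltP s (w x).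
  rewrite [leRHS](_ : _ = m (oint x%:E)); last first.
    congr (m _); apply/seteqP; split=> y //=; first by case.
    move=> xy; split => //; rewrite lte_fin (lt_le_trans swx)// ndw//; first exact: xI.
    by case: xy => _; rewrite lte_fin => /ltW.
  by apply: le_measure; rewrite ?inE; [exact: mvx|exact: mx|move=> y []].
rewrite [leRHS](_ : _ = m [set y | I y /\ (s < w y)%R]); last first.
  congr (m _); apply/seteqP; split=> y /=; first by case=> /xI.
  case=> Iy sw; split => //; split; first by case: Iy.
  rewrite lte_fin ltNge; apply/negP => xy.
  by have := lt_le_trans sw (le_trans (ndw Ix Iy xy) wxs); rewrite ltxx.
rewrite -equimeasurable_weight ?(ltW s0)//.
by apply: le_measure; rewrite ?inE; [exact: mvx|exact: mvs|move=> y [/xI]].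
Qed.

(* Both sides are compared with [d - e], where [d] is the measure of
   [{u < |f|}] and [e] that of [{u < l * v}]; the set on the left is the
   difference of two initial segments of lengths [d] and [e]. *)
Lemma leb_layer_le f l u : L0 I f -> (0 <= l)%R -> (0 <= u)%R ->
  m [set x | I x /\ (l * w x)%:E <= u%:E < rearr m I (EFin \o f) x] <=
  m [set x | I x /\ (l * v x)%:E <= u%:E < (`|f x|)%:E].
Proof.
move=> mf l0 u0; have mEf : measurable_fun (I : set (lebR R)) (EFin \o f) by exact/measurable_EFinP.
set A := [set x | _]; set B := [set x | I x /\ _ <= _ < `|f x|%:E].
pose S := [set x | I x /\ (u < l * w x)%R]; pose S' := [set x | I x /\ (u < l * v x)%R].
pose d := distr m I (EFin \o f) u.
have eS : m S' = m S.
  move: l0; rewrite le_eqVlt => /orP[/eqP l0|l0].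
    by congr (m _); rewrite /S /S' -l0; apply/seteqP; split=> x /=; rewrite !mul0r.
  have e (g : R -> R) : [set x | I x /\ (u < l * g x)%R] = [set x | I x /\ (u / l < g x)%R].
    by apply/seteqP; split=> x /=; rewrite ltr_pdivrMr// mulrC.
  by rewrite /S /S' !e equimeasurable_weight// divr_ge0// ltW.
have mgt (g : R -> R) : L0 I g -> measurable ([set x | I x /\ (u < l * g x)%R] : set (lebR R)).
  move=> mg; have mlg : L0 I (fun x => l * g x)%R by apply: measurable_funM => //; exact: measurable_cst.
  have mu : L0 I (cst u) by exact: measurable_cst.
  by have := measurable_fun_ltr mu mlg => /(_ mI [set true] Logic.I).
have mS : measurable (S : set (lebR R)) by exact: mgt weight_L0.
have mS' : measurable (S' : set (lebR R)) by exact: mgt mv.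
have mle (g : R -> R) (h : R -> \bar R) : L0 I g -> measurable_fun (I : set (lebR R)) h ->
    measurable ([set x | I x /\ (l * g x)%:E <= u%:E < h x] : set (lebR R)).
  move=> mg mh; have := measurableD (emeasurable_fun_o_infty mI mh u%:E) (mgt _ mg).
  congr (measurable _); apply/seteqP; split=> x /=.
    by move=> [[Ix uh] nx]; split => //; rewrite uh andbT lee_fin leNgt; apply/negP => ug; apply: nx.
  move=> [Ix /andP[gu uh]]; split => // -[_]; rewrite ltNge => /negP; apply.
  by rewrite -lee_fin.
have mA : measurable (A : set (lebR R)).
  by apply: mle; [exact: weight_L0|exact: measurable_rearr_leb mIb].
have mB : measurable (B : set (lebR R)).
  apply: mle; first exact: mv.
  by apply/measurable_EFinP; exact: (measurableT_comp (@normr_measurable R setT) mf).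
(* A point [t0] of the layer bounds {u < l w} on the right, so that set has finite measure and may
   be cancelled below. *)
have [->|/set0P[t0 [It0 /andP[lt0 ut0]]]] := eqVneq A set0; first by rewrite measure0.
have t00 : 0 <= t0%:E by case: It0 => /ltW.
have St0 : S `<=` oint t0%:E.
  move=> t [It ut]; split; first by case: It.
  rewrite lte_fin ltNge; apply/negP => t0t; move: ut; rewrite ltNge => /negP; apply.
  by rewrite lee_fin in lt0; apply: le_trans lt0; rewrite ler_wpM2l// ndw.
have mSfin : m S \is a fin_num.
  rewrite ge0_fin_numE//; apply: (@le_lt_trans _ _ t0%:E); rewrite ?ltry//.
  rewrite -[leRHS]leb_oint//; apply: le_measure; rewrite ?inE; [exact: mS|exact: borel_leb (measurable_oint _)|exact: St0].
have ASE : A `|` S = [set t | I t /\ u%:E < rearr m I (EFin \o f) t].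
  apply/seteqP; split=> t /=; first case=> [[It /andP[]]//|[It ut]].
    split => //; apply: lt_le_trans ut0 _; apply: le_rearr.
    by have [_] := St0 _ (conj It ut); rewrite lte_fin => /ltW.
  move=> [It ut]; have [lu|ul] := leP (l * w t)%R u; last by right.
  by left; split => //; rewrite lee_fin lu.
have AS : m A + m S = d.
  rewrite -measureU//; last first.
    apply/seteqP; split=> t //= -[[_ /andP[lu _]] [_ ul]].
    by move: lu; rewrite lee_fin leNgt ul.
  rewrite ASE; apply: (etrans (leb_rearr_gt m mI mEf u0 (ltW a0))).
  by apply/min_idPl; exact: distr_leb_le (ltW a0) mEf.
rewrite -(leeD2rE _ _ mSfin) AS -eS.
apply: (@le_trans _ _ (m (B `|` S'))); last exact: measureU2.
apply: le_measure; rewrite ?inE; [exact: measurable_distr_set|exact: measurableU|].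
move=> t [It ut]; have [lu|ul] := leP (l * v t)%R u; last by right.
by left; split => //; rewrite lee_fin lu.
Qed.

End equimeasurable.
End weight.

(** * From tails of distribution functions to submajorization *)

Lemma measurable_distr (R : realType) (mu : {measure set (lebR R) -> \bar R})
    (D : set R) (f : R -> \bar R) (A : set R) :
  measurable (D : set (lebR R)) -> measurable_fun (D : set (lebR R)) f ->
  measurable (A : set (lebR R)) ->
  measurable_fun (A : set (lebR R)) (distr mu D f).
Proof.
move=> mD mf mA; apply: (@measurable_funS _ _ _ _ setT) => //.
apply: borel_fun_leb => //; apply: nonincreasing_emeasurable => // s t _ _.
exact: le_distr.
Qed.

Lemma integral_rearr (R : realType) (mu : {measure set (lebR R) -> \bar R})
    (D : set R) (f : R -> \bar R) (x : R) :
  measurable (D : set (lebR R)) -> measurable_fun (D : set (lebR R)) f ->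
  (0 <= x)%R ->
  \int[leb R]_(t in oint x%:E) rearr mu D f t =
  \int[leb R]_(s in oint +oo) Order.min (distr mu D f s) x%:E.
Proof.
move=> mD mf x0; have mxb := measurable_oint x%:E.
rewrite (layer_cake (borel_leb mxb) (measurable_rearr_leb mu D f mxb)); last first.
  by move=> t _; exact: rearr_ge0.
apply: eq_integral => s /set_mem[s0 _].
exact: (leb_rearr_gt mu mD mf (ltW s0)).
Qed.

Section tails.
Context (R : realType) (mu1 mu2 : {measure set (lebR R) -> \bar R}) (D1 D2 : set R)
  (f1 f2 : R -> \bar R).
Hypotheses (mD1 : measurable (D1 : set (lebR R))) (mD2 : measurable (D2 : set (lebR R))).
Hypothesis mf1 : measurable_fun (D1 : set (lebR R)) f1.
Hypothesis mf2 : measurable_fun (D2 : set (lebR R)) f2.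
Local Notation m := (leb R).
Local Notation d1 := (distr mu1 D1 f1).
Local Notation d2 := (distr mu2 D2 f2).

(* Split the layer-cake integrals at [l = rearr mu2 D2 f2 x]: below [l] the
   truncation [min d2 x] is [x], above [l] it is [d2]. *)
Lemma le_integral_rearr_of_tails :
  (forall l : R, (0 <= l)%R -> \int[m]_(s in [set s | (l < s)%R]) d1 s <=
                     \int[m]_(s in [set s | (l < s)%R]) d2 s) ->
  forall x : R, (0 <= x)%R ->
  \int[m]_(t in oint x%:E) rearr mu1 D1 f1 t <=
  \int[m]_(t in oint x%:E) rearr mu2 D2 f2 t.
Proof.
move=> tails x x0; rewrite !integral_rearr//.
have mO := borel_leb (measurable_oint (+oo : \bar R)).
have mmin (mu : {measure set (lebR R) -> \bar R}) (D : set R) (f : R -> \bar R) (A : set R) : measurable (D : set (lebR R)) ->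
    measurable_fun (D : set (lebR R)) f -> measurable (A : set (lebR R)) ->
    measurable_fun (A : set (lebR R)) (fun s => Order.min (distr mu D f s) x%:E).
  move=> mD mf mA; have mc : measurable_fun (A : set (lebR R)) (cst x%:E : lebR R -> \bar R).
    exact: measurable_cst.
  exact: (measurable_mine (measurable_distr mu mD mf mA) mc).
have min0 (mu : {measure set (lebR R) -> \bar R}) D f s :
    0 <= Order.min (distr mu D f s) x%:E by rewrite le_min measure_ge0 lee_fin.
have [loo|lfin] := eqVneq (rearr mu2 D2 f2 x) +oo.
  apply: (ge0_le_integral m mO (fun s _ => min0 mu1 D1 f1 s) (mmin _ _ _ _ mD1 mf1 mO)
    (mmin _ _ _ _ mD2 mf2 mO)) => s [s0 _].
  rewrite (@min_r _ _ (d2 s)); first by rewrite ge_min lexx orbT.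
  by rewrite ltW// -(rearr_gtP mu2 x mD2 mf2 (ltW s0)) loo ltry.
have lE : rearr mu2 D2 f2 x = (fine (rearr mu2 D2 f2 x))%:E.
  by rewrite fineK// ge0_fin_numE ?rearr_ge0// ltey.
set l := fine _ in lE; have l0 : (0 <= l)%R by rewrite -lee_fin -lE rearr_ge0.
(* The right-hand side uses [A'] without the endpoint l, because x < d2 s is known only for s < l;
   [A] and [A'] have the same measure. *)
pose A := [set s : R | (0 < s <= l)%R]; pose A' := [set s : R | (0 < s < l)%R].
pose B := [set s : R | (l < s)%R].
have mA : measurable (A : set (lebR R)).
  by have := itv_leb `]0%R, l]; congr (measurable _); apply/seteqP; split=> s; rewrite /= in_itv.
have mA' : measurable (A' : set (lebR R)).
  by have := itv_leb `]0%R, l[; congr (measurable _); apply/seteqP; split=> s; rewrite /= in_itv.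
have mB : measurable (B : set (lebR R)).
  by have := itv_leb `]l, +oo[; congr (measurable _); apply/seteqP; split=> s; rewrite /= in_itv/= andbT.
have mAl : m A = l%:E /\ m A' = l%:E.
  have := @lebesgue_measure_itv R `]0%R, l]; have := @lebesgue_measure_itv R `]0%R, l[.
  rewrite /= lte_fin oppr0 addr0 => h1 h2; split.
    rewrite lebE; have -> : A = [set` `]0%R, l]] by apply/seteqP; split=> s; rewrite /= in_itv.
    by rewrite h2; case: ltgtP l0 => // <-.
  rewrite lebE; have -> : A' = [set` `]0%R, l[] by apply/seteqP; split=> s; rewrite /= in_itv.
  by rewrite h1; case: ltgtP l0 => // <-.
have OE : oint +oo = A `|` B.
  apply/seteqP; split=> s; rewrite /oint/A/B/= ltry.
    by move=> [s0 _]; case: (leP s l) => sl; [left; rewrite s0|right].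
  by case=> [/andP[]|/(le_lt_trans l0)].
have mAB := measurableU _ _ mA mB; have mA'B := measurableU _ _ mA' mB.
have dAB : [disjoint A & B].
  by apply/disj_setPS => s [/= /andP[_ sl]]; rewrite /B /= ltNge sl.
have dA'B : [disjoint A' & B].
  by apply/disj_setPS => s [/= /andP[_ /ltW sl]]; rewrite /B /= ltNge sl.
have mcA : measurable_fun (A : set (lebR R)) (cst x%:E : lebR R -> \bar R) by exact: measurable_cst.
rewrite {1}OE (ge0_integral_setU m mA mB (mmin _ _ _ _ mD1 mf1 mAB) (fun s _ => min0 mu1 D1 f1 s) dAB).
apply: (@le_trans _ _ (\int[m]_(s in A' `|` B) Order.min (d2 s) x%:E)); last first.
  apply: (ge0_subset_integral m mA'B mO (mmin _ _ _ _ mD2 mf2 mO) (fun s _ => min0 mu2 D2 f2 s)).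
  by rewrite OE; apply: setSU => s /andP[s0 sl]; rewrite /A /= s0 ltW.
rewrite (ge0_integral_setU m mA' mB (mmin _ _ _ _ mD2 mf2 mA'B) (fun s _ => min0 mu2 D2 f2 s) dA'B).
apply: leeD.
  apply: (@le_trans _ _ (\int[m]_(s in A) cst x%:E s)).
    apply: (ge0_le_integral m mA (fun s _ => min0 mu1 D1 f1 s) (mmin _ _ _ _ mD1 mf1 mA) mcA).
    by move=> s _; rewrite ge_min lexx orbT.
  rewrite (integral_cst m mA) mAl.1 -mAl.2 -(integral_cst m mA').
  rewrite (eq_integral (cst x%:E)) // => s /set_mem /= /andP[s0 sl]; apply/min_idPr.
  by rewrite ltW// -(rearr_gtP mu2 x mD2 mf2 (ltW s0)) lE lte_fin.
rewrite [leRHS](eq_integral (d2 : lebR R -> \bar R)); last first.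
  move=> s /set_mem /= ls; apply/min_idPl; rewrite leNgt -(rearr_gtP mu2 x mD2 mf2) ?(le_trans l0 (ltW ls))//.
  by rewrite lE -leNgt lee_fin ltW.
apply: le_trans (tails _ l0).
apply: (ge0_le_integral m mB (fun s _ => min0 mu1 D1 f1 s) (mmin _ _ _ _ mD1 mf1 mB) (measurable_distr mu1 mD1 mf1 mB)).
by move=> s _; rewrite ge_min lexx.
Qed.

End tails.

Section submajorization.
Context (R : realType) (a : \bar R) (w f v : R -> R).
Hypothesis a0 : 0 < a.
Hypothesis w_gt0 : forall t, oint a t -> (0 < w t)%R.
Hypothesis ndw : forall s t, oint a s -> oint a t -> (s <= t)%R -> (w t <= w s)%R.
Hypothesis mf : L0 (oint a) f.
Hypothesis adm : admissible (oint a) w f v.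
Local Notation I := (oint a).
Local Notation m := (leb R).

Let mI : measurable (I : set (lebR R)) := borel_leb (measurable_oint a).

Lemma measurable_rearr_over : measurable_fun (I : set (lebR R)) (rearr_over I w f).
Proof.
apply: (borel_fun_leb (measurable_oint a)).
have mw1 : measurable_fun (I : set (measurableTypeR R)) (fun t => ((w t)^-1)%:E).
  apply/measurable_EFinP.
  exact: (measurableT_comp (@measurable_inv R) (weight_measurable ndw)).
exact: (emeasurable_funM (measurable_rearr m I (EFin \o f) (measurable_oint a)) mw1).
Qed.

Lemma rearr_over_ge0 t : I t -> 0 <= rearr_over I w f t.
Proof.
by move=> It; rewrite mule_ge0 ?rearr_ge0// lee_fin invr_ge0 ltW// w_gt0.
Qed.

Lemma tail_le l : (0 <= l)%R ->
  \int[m]_(s in [set s | (l < s)%R]) distr (wmeas w) I (rearr_over I w f) s <=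
  \int[m]_(s in [set s | (l < s)%R]) distr (wmeas v) I (EFin \o quot f v) s.
Proof.
move=> l0; have [mv v0 vw fv] := adm; have mw : L0 I w by exact: weight_L0.
rewrite [leLHS](eq_integral (fun s : lebR R => wmeas w [set x | I x /\
    s%:E < rearr m I (EFin \o f) x * (w x)^-1%:E])); last first.
  move=> s _; congr (wmeas w _); apply/seteqP; split=> x [Ix]; by rewrite /= gee0_abs ?rearr_over_ge0.
rewrite [leRHS](eq_integral (fun s : lebR R => wmeas v [set x | I x /\
    s%:E < `|f x|%:E * (v x)^-1%:E])); last first.
  move=> s _; congr (wmeas v _); apply/seteqP; split=> x [Ix];
  by rewrite /= /quot normrM normfV (ger0_norm (v0 _ Ix)) EFinM.
have mr := measurable_rearr_leb m I (EFin \o f) (measurable_oint a).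
have maf : measurable_fun (I : set (lebR R)) (fun x => `|f x|%:E).
  by apply/measurable_EFinP; exact: (measurableT_comp (@normr_measurable R setT) mf).
rewrite (layer_quotient mI mw (fun x Ix => ltW (w_gt0 Ix)) mr (fun x _ => rearr_ge0 _ _ _ x) l0); last first.
  by apply: aeW => x Ix wx; have := w_gt0 Ix; rewrite wx ltxx.
have af0 x : I x -> 0 <= `|f x|%:E by rewrite lee_fin.
rewrite (layer_quotient mI mv v0 maf af0 l0); last first.
  apply: ae_leb_mono fv => x fv Ix vx; apply/eqP; rewrite eqe normr_eq0.
  by apply/negPn/negP => /(fv Ix); rewrite vx eqxx.
have mO := borel_leb (measurable_oint (+oo : \bar R)).
apply: (ge0_le_integral m mO (fun _ _ => measure_ge0 _ _)
  (measurable_leb_layer l mI mw mr) (measurable_leb_layer l mI mv maf)).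
move=> u [u0 _]; exact: (leb_layer_le a0 ndw mv v0 vw mf l0 (ltW u0)).
Qed.

(** No membership or finiteness is assumed: in the second claim this inequality is itself the source
    of the finiteness of the left-hand rearrangement. *)
Lemma rearr_over_submaj x : (0 <= x)%R ->
  \int[m]_(t in oint x%:E) rearr (wmeas w) I (rearr_over I w f) t <=
  \int[m]_(t in oint x%:E) rearr (wmeas v) I (EFin \o quot f v) t.
Proof.
move=> x0; have [mv v0 vw fv] := adm; have mw : L0 I w by exact: weight_L0.
have [mu1 mu1E] := wmeas_measure mI mw (fun x Ix => ltW (w_gt0 Ix)).
have [mu2 mu2E] := wmeas_measure mI mv v0.
have mq : measurable_fun (I : set (lebR R)) (EFin \o quot f v).
  by apply/measurable_EFinP; exact: L0_quot.
have e1 s := distr_wmeas s mI mu1E measurable_rearr_over.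
have e2 s := distr_wmeas s mI mu2E mq.
rewrite (eq_rearr (fun s _ => e1 s)) (eq_rearr (fun s _ => e2 s)).
apply: (le_integral_rearr_of_tails mI mI measurable_rearr_over mq) => // l l0.
have := tail_le l0.
by rewrite (_ : distr (wmeas w) _ _ = distr mu1 I (rearr_over I w f))
  1?(_ : distr (wmeas v) _ _ = distr mu2 I (EFin \o quot f v))//; apply/funext.
Qed.

End submajorization.

(** * Lower bound: pulling the weight back along a rank *)

Section rank_weight.
Context (R : realType) (a : \bar R) (w f q : R -> R) (theta : R).
Hypothesis a0 : 0 < a.
Hypothesis w_gt0 : forall t, oint a t -> (0 < w t)%R.
Hypothesis ndw : forall s t, oint a s -> oint a t -> (s <= t)%R -> (w t <= w s)%R.
Hypothesis mf : L0 (oint a) f.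
Hypothesis mq : L0 (oint a) q.
Hypothesis theta0 : (0 < theta)%R.
Local Notation I := (oint a).
Local Notation m := (leb R).
Local Notation d := (superdistr (leb R) (oint a) q).
Local Notation sigma x := (fine (d (q x))).
Hypothesis q_level0 : forall c, m [set x | I x /\ q x = c] = 0.
Hypothesis d_bounded : forall t, I t -> exists c, t%:E <= d c < +oo.
Hypothesis d_small : forall t, I t -> exists c, d c < t%:E.
Hypothesis f_fin : forall x, I x -> f x != 0%R -> d (q x) < +oo.
Hypothesis f_le : forall x, I x -> f x != 0%R ->
  (forall r : rat, (sigma x)%:E <> distr m I (EFin \o f) (ratr r)) ->
  `|f x|%:E <= theta%:E * rearr m I (EFin \o f) (sigma x).

Let mI : measurable (I : set (lebR R)) := borel_leb (measurable_oint a).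
Let mIb : measurable (I : set (measurableTypeR R)) := measurable_oint a.
Let F := [set x | I x /\ d (q x) < +oo].

Let mF : measurable (F : set (lebR R)).
Proof. exact: (emeasurable_fun_infty_o mI (measurable_superdistr m mI mq)). Qed.

Let msig : L0 F (fun x => sigma x).
Proof.
have md : measurable_fun (F : set (lebR R)) (superdistr m I q \o q).
  by apply: measurable_funS (measurable_superdistr m mI mq) => // x [].
exact: (measurableT_comp (@fine_measurable R setT measurableT) md).
Qed.

Let mpre (C : set R) : measurable (C : set (measurableTypeR R)) ->
  measurable ([set x | F x /\ C (sigma x)] : set (lebR R)).
Proof. by move=> mC; have := msig mF mC. Qed.

Let transport (C : set R) : measurable (C : set (measurableTypeR R)) ->
  m [set x | F x /\ C (sigma x)] = m (C `&` I).
Proof.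
move=> mC; have mE : m I = a by rewrite leb_oint// ltW.
have db t : oint (m I) t -> exists c, t%:E <= d c < +oo by rewrite mE; exact: d_bounded.
have ds t : oint (m I) t -> exists c, d c < t%:E by rewrite mE; exact: d_small.
have := rank_transport mI mq q_level0 db ds mC; rewrite mE => <-.
by congr (m _); apply/seteqP; split=> x /=; [case=> -[]|case=> ? ? ?; split].
Qed.

(** The value 0 is a default for points whose rank is infinite or lies outside [I]. Among the points
    with f x != 0 these form a null set, so [v] remains admissible. *)
Let v (x : R) : R := if `[< F x /\ I (sigma x) >] then w (sigma x) else 0%R.

Let vE x : F x -> I (sigma x) -> v x = w (sigma x).
Proof. by move=> Fx Isx; rewrite /v asboolT. Qed.

Let v_gt0 x : (0 < v x)%R -> F x /\ I (sigma x).
Proof. by rewrite /v; case: asboolP => //; rewrite ltxx. Qed.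

Let v_ge0 x : (0 <= v x)%R.
Proof. by rewrite /v; case: asboolP => // -[_ /w_gt0/ltW]. Qed.

Let C_ s := [set t | I t /\ (s < w t)%R].

Let mC_ s : measurable (C_ s : set (measurableTypeR R)).
Proof.
have mw : measurable_fun (I : set (measurableTypeR R)) (EFin \o w).
  by apply/measurable_EFinP; exact: weight_measurable ndw.
exact: (emeasurable_fun_o_infty mIb mw s%:E).
Qed.

Let v_gtE s (B : set R) : (0 <= s)%R ->
  [set x | (F x /\ B (sigma x)) /\ (s < v x)%R] = [set x | F x /\ (B `&` C_ s) (sigma x)].
Proof.
move=> s0; apply/seteqP; split=> x /=.
  move=> [[Fx Bx] sv]; have [_ Is] := v_gt0 (le_lt_trans s0 sv).
  by split => //; split => //; split => //; rewrite -(vE Fx Is).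
by move=> [Fx [Bx [Is sw]]]; split => //; rewrite vE.
Qed.

Let v_gtI s : (0 <= s)%R ->
  [set x | I x /\ (s < v x)%R] = [set x | F x /\ C_ s (sigma x)].
Proof.
move=> s0; have := v_gtE setT s0; rewrite setTI => <-.
apply/seteqP; split=> x /=; first by move=> [_ sv]; split => //; have [] := v_gt0 (le_lt_trans s0 sv).
by move=> [[[Ix _] _] sv].
Qed.

Let mv : L0 I v.
Proof.
move=> _; apply: (measurability _ (RGenOInfty.measurableE R)) => // _ [_ [s ->] <-].
have [s0|s0] := leP 0%R s.
  have := mpre (mC_ s); rewrite -v_gtI//; congr (measurable _).
  by apply/seteqP; split=> x /=; rewrite in_itv/= andbT.
rewrite (_ : _ `&` _ = I)//; apply/seteqP; split=> x /=; first by case.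
by move=> Ix; split => //; rewrite in_itv/= andbT (lt_le_trans s0).
Qed.

Let equi s : (0 <= s)%R ->
  m [set x | I x /\ (s < v x)%R] = m [set x | I x /\ (s < w x)%R].
Proof.
by move=> s0; rewrite v_gtI// transport// setIidl// => x [].
Qed.

Let vw : {ae m, forall t, I t -> rearr m I (EFin \o v) t = (w t)%:E}.
Proof.
rewrite (_ : rearr m I (EFin \o v) = rearr m I (EFin \o w)).
  exact: (rearr_weight w_gt0 ndw).
apply: eq_rearr => s s0; have := equi (ltW s0); congr (_ = _); congr (m _);
  apply/seteqP; split=> x [Ix] /=; rewrite lte_fin ger0_norm// ltW// w_gt0//.
Qed.

Let fv : {ae m, forall x, I x -> f x != 0%R -> v x != 0%R}.
Proof.
apply/ae_lebP; have mC : measurable (~` I : set (measurableTypeR R)) by exact: measurableC.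
have nN : m.-negligible ([set x | F x /\ (~` I) (sigma x)] : set (lebR R)).
  apply/(negligibleP m); first exact: (mpre mC).
  by apply: (etrans (transport mC)); rewrite setICl measure0.
apply: negligibleS nN => x /= h; have [Ix [fx vx]] : I x /\ f x != 0%R /\ v x = 0%R.
  apply: contrapT => n; apply: h => Ix fx; apply/eqP => vx; exact: n.
have Fx : F x by split => //; exact: f_fin.
by split => // Is; have := w_gt0 Is; rewrite -(vE Fx Is) vx ltxx.
Qed.

(** Change of variables by layers: {v > s} within the preimage of [C] is the preimage of the part of
    [C] where w > s, and sigma preserves Lebesgue measure. *)
Let wmeas_pre (C : set R) : measurable (C : set (measurableTypeR R)) -> C `<=` I ->
  wmeas v [set x | F x /\ C (sigma x)] = wmeas w C.
Proof.
move=> mC CI; have mP := mpre mC; have mCl := borel_leb mC.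
have mv' : measurable_fun ([set x | F x /\ C (sigma x)] : set (lebR R)) (EFin \o v).
  by apply/measurable_EFinP; apply: measurable_funS mv => // x [[]].
have mw' : measurable_fun (C : set (lebR R)) (EFin \o w).
  by apply/measurable_EFinP; apply: measurable_funS (weight_L0 ndw).
rewrite /wmeas (layer_cake mP mv'); last by move=> x _; rewrite lee_fin.
rewrite (layer_cake mCl mw'); last by move=> x /CI Ix; rewrite lee_fin ltW// w_gt0.
apply: eq_integral => s /set_mem[s0 _].
rewrite (_ : [set x | [set x | F x /\ C (sigma x)] x /\ _] =
  [set x | (F x /\ C (sigma x)) /\ (s < v x)%R])// v_gtE ?(ltW s0)//.
rewrite transport; last exact: measurableI.
congr (m _); apply/seteqP; split=> t /=; first by case=> -[Ct [_ st]].
by move=> [Ct st]; split => //; [split => //; split => //|]; exact: CI.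
Qed.

(** As v = w o sigma and |f| <= theta (f^* o sigma) almost everywhere where f is nonzero, the set
    {|f|/v > s} lies up to a null set in the sigma-preimage of {f^*/w > s/theta}, whose v-mass is
    given by [wmeas_pre]. *)
Lemma rank_weight : exists2 v, admissible I w f v &
  forall s, (0 < s)%R -> distr (wmeas v) I (EFin \o quot f v) s <=
    distr (wmeas w) I (rearr_over I w f) (s / theta).
Proof.
exists v; first by split.
(* [Bd] holds the ranks at which [f_le] says nothing. It is countable, so its preimage under sigma
   is null. *)
move=> s s0; pose Bd := [set t : R | exists r : rat, t%:E = distr m I (EFin \o f) (ratr r)].
have cBd : countable Bd by exact: countable_distr_rat.
have mBd : measurable (Bd : set (measurableTypeR R)) by exact: countable_measurable.
pose N := [set x | F x /\ Bd (sigma x)]; have mN : measurable (N : set (lebR R)) by exact: mpre.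
have N0 : m N = 0.
  apply: (etrans (transport mBd)); apply: leb_countable.
  by apply: sub_countable cBd; apply: subset_card_le => t [].
have mqf : measurable_fun (I : set (lebR R)) (EFin \o quot f v).
  by apply/measurable_EFinP; exact: L0_quot.
have mA := measurable_distr_set mI s mqf.
have mAv : measurable_fun ([set x | I x /\ s%:E < `|(EFin \o quot f v) x|] : set (lebR R)) (EFin \o v).
  by apply/measurable_EFinP; apply: measurable_funS mv => // x [].
pose C := [set t | I t /\ (s / theta)%:E < `|rearr_over I w f t|].
have mC : measurable (C : set (measurableTypeR R)).
  have mw1 : measurable_fun (I : set (measurableTypeR R)) (fun t => ((w t)^-1)%:E).
    apply/measurable_EFinP.
    exact: (measurableT_comp (@measurable_inv R) (weight_measurable ndw)).
  have mr := emeasurable_funM (measurable_rearr m I (EFin \o f) mIb) mw1.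
  exact: (emeasurable_fun_o_infty mIb (measurableT_comp (@abse_measurable R setT) mr)).
rewrite /distr -(wmeas_pre mC) ?/wmeas; last by move=> x [].
rewrite (ge0_negligible_integral mN mA mAv _ N0); last by move=> x _; rewrite lee_fin.
have mvI : measurable_fun ([set x | F x /\ C (sigma x)] : set (lebR R)) (EFin \o v).
  by apply/measurable_EFinP; apply: measurable_funS mv => // x [[]].
apply: (ge0_subset_integral m (measurableD mA mN) (mpre mC) mvI).
  by move=> x _; rewrite lee_fin.
move=> x [[Ix sx] Nx]; have vx : v x != 0%R.
  by apply/eqP => vx; move: sx; rewrite /= /quot vx invr0 mulr0 normr0 lte_fin ltNge (ltW s0).
have vp : (0 < v x)%R by rewrite lt_neqAle eq_sym vx v_ge0.
have [Fx Is] := v_gt0 vp; split => //; split => //.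
have fx : f x != 0%R.
  by apply/eqP => fx; move: sx; rewrite /= /quot fx mul0r normr0 lte_fin ltNge (ltW s0).
have := f_le Ix fx (fun r rE => Nx (conj Fx (ex_intro _ r rE))).
have wp := w_gt0 Is.
rewrite gee0_abs ?rearr_over_ge0// /rearr_over.
move: sx; rewrite /= /quot (vE Fx Is) normrM normfV (gtr0_norm wp) lte_fin.
rewrite ltr_pdivlMr// => sx.
have := rearr_ge0 m I (EFin \o f) (sigma x).
case: (rearr m I (EFin \o f) (sigma x)) => [r _| _ _|//].
  rewrite -EFinM lee_fin => h; rewrite -EFinM lte_fin ltr_pdivlMr// mulrAC ltr_pdivrMr//.
  by rewrite (mulrC r); exact: lt_le_trans h.
by rewrite gt0_mulye ?ltry// lte_fin invr_gt0.
Qed.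

End rank_weight.

(** * Lower bound: ranking by geometric bands, with a last band below the level c *)

Section bands.
Context (R : realType) (a : \bar R) (f : R -> R) (theta c : R).
Hypothesis a0 : 0 < a.
Hypothesis mf : L0 (oint a) f.
Hypothesis theta1 : (1 < theta)%R.
Hypothesis c0 : (0 <= c)%R.
Local Notation I := (oint a).
Local Notation m := (leb R).
Local Notation df := (distr (leb R) (oint a) (EFin \o f)).
Hypothesis c_low : c = 0%R \/ df (c / theta) = +oo.
Hypothesis c_fin : df c < +oo \/ c = 0%R /\ forall s, (0 < s)%R -> df s < +oo.
Hypothesis f_small : forall t, I t -> exists2 s, (0 < s)%R & df s <= t%:E.

Let mI : measurable (I : set (lebR R)) := borel_leb (measurable_oint a).
Let theta0 : (0 < theta)%R. Proof. exact: lt_trans theta1. Qed.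
Let kappa := ln theta.
Let kappa0 : (0 < kappa)%R. Proof. exact: ln_gt0. Qed.
Let mEf : measurable_fun (I : set (lebR R)) (EFin \o f).
Proof. exact/measurable_EFinP. Qed.

(* [band x] is the integer [k] with [theta ^ k <= |f x| < theta ^ (k + 1)]. *)
Let band x : int := Num.floor (ln `|f x| / kappa)%R.
Let lev (k : int) : R := expR (k%:~R * kappa).

Let lev_le (k : int) s : (0 < s)%R -> (k <= Num.floor (ln s / kappa))%R = (lev k <= s)%R.
Proof.
move=> s0; by rewrite floor_ge_int ler_pdivlMr// -(ler_expR _ (ln s)) lnK.
Qed.

Let lt_lev s : (0 < s)%R -> (s < theta * lev (Num.floor (ln s / kappa)))%R.
Proof.
move=> s0; have := floorD1_gt (ln s / kappa)%R.
rewrite ltr_pdivrMr// -ltr_expR lnK// intrD mulrDl mul1r expRD.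
by have -> : theta = expR kappa; [rewrite lnK|rewrite mulrC].
Qed.

(* [q] is injective on each band and decreasing along it, so that its level
   sets are null and its distribution function ranks the points of [I]. *)
Let q x : R := if (c < `|f x|)%R then expR ((band x)%:~R + (1 + x)^-1) else (- x)%R.
Local Notation dq := (superdistr m I q).

(** Staying strictly between 0 and 1, the position (1 + x)^-1 cannot reach the next band index, so
    bands do not interleave. The exponential makes [q] positive there, above the negative values - x
    of the last band. *)
Let frac_itv x : I x -> (0 < (1 + x)^-1 < 1)%R.
Proof.
move=> [x0 _]; have x1 : (1 < 1 + x)%R by rewrite ltrDl.
by rewrite invr_gt0 (lt_trans ltr01 x1)/= invf_lt1// (lt_trans ltr01).
Qed.

Let mq : L0 I q.
Proof.
have maf : L0 I (fun x => `|f x|%R) := measurableT_comp (@normr_measurable R setT) mf.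
have mc : L0 I (cst c) by exact: measurable_cst.
have mid : L0 I id by exact: measurable_id_leb.
have m1 : L0 I (cst 1%R) by exact: measurable_cst.
have mfrac : L0 I (fun x => (1 + x)^-1)%R.
  exact: (measurableT_comp (@measurable_inv R) (measurable_funD m1 mid)).
have mfl : measurable_fun setT (fun y : R => (Num.floor (ln y / kappa))%:~R : R).
  have mfl' : measurable_fun setT (fun y : R => (Num.floor (y / kappa))%:~R : R).
    apply: nondecreasing_measurable => // x y xy.
    rewrite ler_int floor_ge_int (le_trans (floor_le _))//.
    by rewrite ler_pM2r ?invr_gt0.
  exact: (measurableT_comp mfl' (@measurable_ln R)).
have mexp : L0 I (fun x => expR ((band x)%:~R + (1 + x)^-1)).
  exact: (measurableT_comp (@measurable_expR R) (measurable_funD (measurableT_comp mfl maf) mfrac)).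
have mopp : L0 I (fun x => - x)%R by exact: (measurable_funN mid).
apply: (measurable_fun_if mI (measurable_fun_ltr mc maf)).
- by apply: measurable_funS mexp => // x [].
- by apply: measurable_funS mopp => // x [].
Qed.

Let q_inj x y : I x -> I y -> q x = q y -> x = y.
Proof.
move=> Ix Iy; rewrite /q; case: ifPn => fx; case: ifPn => fy.
- move=> /expR_inj.
  wlog : x y Ix Iy fx fy / (band x <= band y)%R.
    move=> h e; have [xy|yx] := leP (band x) (band y); first exact: h.
    by apply/esym/h => //; exact: ltW.
  rewrite le_eqVlt => /orP[/eqP-> /addrI /invr_inj /addrI//|].
  rewrite -lezD1 => xy e.
  have /andP[u0 u1] := frac_itv Ix; have /andP[v0 v1] := frac_itv Iy.
  have : ((band x)%:~R + 1 <= (band y)%:~R :> R)%R by rewrite -(intrD _ _ 1%Z) ler_int.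
  lra.
- by move=> e; have := expR_gt0 ((band x)%:~R + (1 + x)^-1); rewrite e oppr_gt0; case: Iy => /ltW; rewrite leNgt => /negP.
- by move=> e; have := expR_gt0 ((band y)%:~R + (1 + y)^-1); rewrite -e oppr_gt0; case: Ix => /ltW; rewrite leNgt => /negP.
- by move/oppr_inj.
Qed.

Let q_level0 k : m [set x | I x /\ q x = k] = 0.
Proof.
have [->|/set0P[x0 [Ix0 <-]]] := eqVneq [set x | I x /\ q x = k] set0.
  by rewrite measure0.
rewrite (_ : [set x | _] = [set x0]) ?leb_set1//.
by apply/seteqP; split=> x /=; [case=> Ix /q_inj -> //|move=> ->].
Qed.

(** The level [expR k] falls in the gap between the values of [q] on band k - 1 and those on band
    k. *)
Let q_gtE (k : int) x : I x ->
  (expR k%:~R < q x)%R <-> (c < `|f x|)%R /\ (lev k <= `|f x|)%R.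
Proof.
move=> Ix; rewrite /q; case: ifPn => fx; last first.
  split; last by case.
  move=> h; exfalso; have := lt_trans (expR_gt0 _) h; rewrite oppr_gt0.
  by case: Ix => /ltW; rewrite leNgt => /negP.
rewrite ltr_expR -lev_le; last exact: le_lt_trans c0 fx.
rewrite -/(band x); have /andP[u0 u1] := frac_itv Ix; split.
  move=> h; split => //; rewrite leNgt; apply/negP; rewrite -lezD1 => h'.
  have : ((band x)%:~R + 1 <= k%:~R :> R)%R by rewrite -(intrD _ _ 1%Z) ler_int.
  by move: h u1 u0; lra.
by move=> [_]; rewrite -(ler_int R); move: u0; lra.
Qed.

Let mgt k : measurable ([set x | I x /\ (k < q x)%R] : set (lebR R)).
Proof. exact: measurable_superdistr_set. Qed.

Let dq_le_df (k : int) s : (s < lev k)%R -> dq (expR k%:~R) <= df s.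
Proof.
move=> sk; apply: le_measure; rewrite ?inE; [exact: mgt|exact: measurable_distr_set|].
move=> x [Ix /(q_gtE _ Ix)[_ kf]]; split => //.
by rewrite lte_fin; exact: lt_le_trans kf.
Qed.

Let dq_fin (k : int) : dq (expR k%:~R) < +oo.
Proof.
case: c_fin => [cf|[_ cf]].
  apply: le_lt_trans cf; apply: le_measure; rewrite ?inE; [exact: mgt|exact: measurable_distr_set|].
  by move=> x [Ix /(q_gtE _ Ix)[cfx _]].
have k0 : (0 < lev k)%R := expR_gt0 _.
apply: le_lt_trans (cf (lev k / 2)%R _); last by rewrite divr_gt0.
by apply: dq_le_df; rewrite ltr_pdivrMr// ltr_pMr// ltr1n.
Qed.

Let dq_opp t : (0 <= t)%R -> dq (- t)%R <= df c + t%:E.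
Proof.
move=> t0; rewrite -[X in _ + X](leb_oint (c := t%:E)) ?lee_fin//.
have mt := borel_leb (measurable_oint t%:E).
have md := measurable_distr_set mI c mEf.
apply: (@le_trans _ _ (m ([set x | I x /\ c%:E < `|(EFin \o f) x|] `|` oint t%:E))); last exact: measureU2.
apply: le_measure; rewrite ?inE; [exact: mgt|exact: measurableU|].
move=> x [Ix]; rewrite /q; case: ifPn => [cf _|_]; first by left; split.
by rewrite ltrN2 => xt; right; split => //; case: Ix.
Qed.

Let d_small t : I t -> exists k, dq k < t%:E.
Proof.
move=> It; have [t0 ta] := It.
(* [f_small] is a weak inequality while a strict one is wanted, hence t / 2. *)
have It2 : I (t / 2)%R.
  split; first by rewrite divr_gt0.
  by apply: le_lt_trans ta; rewrite lee_fin ler_pdivrMr// ler_pMr// ler1n.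
have [s s0 st] := f_small It2.
exists (expR (Num.floor (ln s / kappa) + 1)%:~R).
apply: (@le_lt_trans _ _ (df s)).
  apply: dq_le_df; rewrite ltNge -lev_le// -ltNge.
  by rewrite ltzD1.
by apply: le_lt_trans st _; rewrite lte_fin ltr_pdivrMr// ltr_pMr// ltr1n.
Qed.

(** If [df c] is finite, the level - t works: {q > - t} contains (0, t) and has measure at most df c
    + t. Otherwise c = 0 and df 0 is infinite; right continuity gives s > 0 with df s > t, and the
    lower end of the band of s provides a level of finite measure. *)
Let d_bounded t : I t -> exists k, t%:E <= dq k < +oo.
Proof.
move=> It; have [t0 ta] := It; have [dc|dc] := ltP (df c) +oo.
  exists (- t)%R; apply/andP; split; last first.
    by apply: le_lt_trans (dq_opp (ltW t0)) _; rewrite lte_add_pinfty// ltry.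
  rewrite -[leLHS]leb_oint; last by rewrite lee_fin ltW.
  have mt := borel_leb (measurable_oint t%:E).
  apply: le_measure; rewrite ?inE; [exact: mt|exact: mgt|].
  move=> x [x0 xt]; split; first by split => //; exact: lt_trans ta.
  by rewrite /q; case: ifPn => _; [rewrite (lt_trans _ (expR_gt0 _))// oppr_lt0|rewrite ltrN2].
case: c_fin => [|[c00 cf]]; first by rewrite ltNge dc.
have : t%:E < df 0 by rewrite -c00 (lt_le_trans _ dc)// ltry.
move=> /(distr_right mI mEf)[s s0 ts].
exists (expR (Num.floor (ln s / kappa))%:~R); rewrite dq_fin andbT.
apply: le_trans (ltW ts) _; apply: le_measure; rewrite ?inE; [exact: measurable_distr_set|exact: mgt|].
move=> x [Ix]; rewrite lte_fin => sf; split => //; apply/(q_gtE _ Ix).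
split; first by rewrite c00 (lt_trans s0).
by apply: le_trans (ltW sf); rewrite -lev_le.
Qed.

Let f_fin x : I x -> f x != 0%R -> dq (q x) < +oo.
Proof.
move=> Ix fx; have [cf|fc] := ltP c `|f x|%R.
  apply: le_lt_trans (dq_fin (band x)); apply: le_superdistr => //.
  rewrite /q cf ler_expR lerDl ltW//.
  by have /andP[] := frac_itv Ix.
rewrite /q ifF; last by rewrite ltNge fc.
have [x0 _] := Ix.
have cp : (0 < c)%R by apply: lt_le_trans fc; rewrite normr_gt0.
apply: le_lt_trans (dq_opp (ltW x0)) _; rewrite lte_add_pinfty// ?ltry//.
by case: c_fin => // -[c00]; rewrite c00 ltxx in cp.
Qed.

(** Above [c], |f x| is less than theta times the lower end of its band, and f^* is at least that
    lower end at the rank of x. In the last band |f x| <= c, while f^* exceeds c / theta everywhere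
    because [df] is infinite at c / theta. *)
Let f_le x : I x -> f x != 0%R ->
  (forall r : rat, (fine (dq (q x)))%:E <> df (ratr r)) ->
  `|f x|%:E <= theta%:E * rearr m I (EFin \o f) (fine (dq (q x))).
Proof.
move=> Ix fx nt; have fx0 : (0 < `|f x|)%R by rewrite normr_gt0.
have dE : (fine (dq (q x)))%:E = dq (q x) by rewrite fineK// ge0_fin_numE ?measure_ge0// f_fin.
have [cf|fc] := ltP c `|f x|%R.
  apply: (@le_trans _ _ (theta%:E * (lev (band x))%:E)).
    by rewrite -EFinM lee_fin ltW// lt_lev.
  apply: lee_wpmul2l; first by rewrite lee_fin ltW.
  apply: (rearr_ge mI mEf nt) => s /andP[s0 sl]; rewrite dE.
  apply: (@le_trans _ _ (dq (expR (band x)%:~R))).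
    apply: le_superdistr => //; rewrite /q cf ler_expR lerDl ltW//.
    by have /andP[] := frac_itv Ix.
  exact: dq_le_df.
have cp : (0 < c)%R by exact: lt_le_trans fc.
have doo : df (c / theta) = +oo by case: c_low => // c00; rewrite c00 ltxx in cp.
apply: (@le_trans _ _ (theta%:E * (c / theta)%:E)).
  by rewrite -EFinM lee_fin mulrC divfK// gt_eqF.
apply: lee_wpmul2l; first by rewrite lee_fin ltW.
rewrite ltW// (rearr_gtP m _ mI mEf) ?doo ?ltry//.
by rewrite divr_ge0// ltW.
Qed.

Lemma band_weight (w : R -> R) :
  (forall t, I t -> (0 < w t)%R) ->
  (forall s t, I s -> I t -> (s <= t)%R -> (w t <= w s)%R) ->
  exists2 v, admissible I w f v &
  forall s, (0 < s)%R -> distr (wmeas v) I (EFin \o quot f v) s <=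
    distr (wmeas w) I (rearr_over I w f) (s / theta).
Proof.
move=> w0 ndw.
exact: (rank_weight a0 w0 ndw mf mq theta0 q_level0 d_bounded d_small f_fin f_le).
Qed.

End bands.

(** If every positive level of |f| is exceeded on a set of finite measure, all nonzero values can be
    cut into bands and c = 0 works. Otherwise [inf C] is the positive limit of f^* at infinity, and
    a cut slightly above it is needed. *)
Lemma exists_weight (R : realType) (a : \bar R) (w f : R -> R) (theta : R) :
  0 < a ->
  (forall t, oint a t -> (0 < w t)%R) ->
  (forall s t, oint a s -> oint a t -> (s <= t)%R -> (w t <= w s)%R) ->
  L0 (oint a) f -> (1 < theta)%R ->
  (forall t, oint a t -> rearr (leb R) (oint a) (EFin \o f) t < +oo) ->
  exists2 v, admissible (oint a) w f v &
  forall s, (0 < s)%R -> distr (wmeas v) (oint a) (EFin \o quot f v) s <=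
    distr (wmeas w) (oint a) (rearr_over (oint a) w f) (s / theta).
Proof.
move=> a0 w0 ndw mf theta1 rfin; have th0 : (0 < theta)%R := lt_trans ltr01 theta1.
pose df := distr (leb R) (oint a) (EFin \o f).
have mI := borel_leb (measurable_oint a).
have mEf : measurable_fun (oint a : set (lebR R)) (EFin \o f) by exact/measurable_EFinP.
have f_small t : oint a t -> exists2 s, (0 < s)%R & df s <= t%:E.
  move=> /rfin /ereal_inf_lt[_ [s [s0 st] _] _]; by exists s.
have [t0 It0] : exists t, oint a t.
  case: a a0 {w0 ndw mf rfin df mI mEf f_small} => [a'| |]//; rewrite ?lte_fin.
    by move=> a'0; exists (a' / 2)%R; split; rewrite ?divr_gt0// lte_fin ltr_pdivrMr// ltr_pMr// ltr1n.
  by move=> _; exists 1%R; split => //; rewrite ltry.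
have [allfin|] := pselect (forall s, (0 < s)%R -> df s < +oo).
  exact: (band_weight a0 mf theta1 (lexx 0%R) (or_introl erefl) (or_intror (conj erefl allfin)) f_small w0 ndw).
move=> /existsNP[s0 /not_implyP[s00 /negP]]; rewrite -leNgt leye_eq => /eqP ds0.
pose C := [set s : R | (0 < s)%R /\ df s < +oo].
have C0 : C !=set0.
  by have [s s1 ds] := f_small _ It0; exists s; split => //; apply: le_lt_trans ds _; rewrite ltry.
have lbC : lbound C s0.
  move=> s [_ ds]; rewrite leNgt; apply/negP => ss0; move: ds.
  by rewrite ltNge (le_trans _ (le_distr (leb R) mI mEf (ltW ss0)))// -/df ds0.
have s0c : (s0 <= inf C)%R by apply: lb_le_inf.
have cp : (0 < inf C)%R := lt_le_trans s00 s0c.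
(* The midpoint of [inf C] and theta times [inf C]: above [inf C], so [df c] is finite, and c /
   theta is below [inf C], so [df] is infinite there. *)
pose c := (inf C * (1 + theta) / 2)%R.
have c0 : (0 <= c)%R by rewrite /c divr_ge0// mulr_ge0 ?ltW// ltr_wpDl.
have ic : (inf C < c)%R.
  by rewrite /c -mulrA ltr_pMr// ltr_pdivlMr// mul1r ltrD2l.
have [s [s1 ds] sc] := inf_lt C0 ic.
have c_fin : df c < +oo.
  by apply: le_lt_trans ds; apply: le_distr => //; exact: ltW.
have c_low : df (c / theta)%R = +oo.
  apply/eqP; rewrite -leye_eq leNgt; apply/negP => dc.
  have ct : (c / theta < inf C)%R.
    rewrite ltr_pdivrMr// /c -mulrA ltr_pM2l// ltr_pdivrMr//.
    by rewrite mulr_natr mulr2n ltrD2r.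
  have cC : C (c / theta)%R by split => //; rewrite divr_gt0// (lt_trans cp ic).
  have hC : has_lbound C by exists s0.
  by have := ge_inf hC cC; rewrite leNgt ct.
exact: (band_weight a0 mf theta1 c0 (or_intror c_low) (or_introl c_fin) f_small w0 ndw).
Qed.

(** * Rearrangements of rearrangements and properties of the space E *)

Lemma L0_ae (R : realType) (D : set R) (g h : R -> R) :
  measurable (D : set (lebR R)) -> L0 D h ->
  {ae leb R, forall x, D x -> g x = h x} -> L0 D g.
Proof.
move=> mD mh gh _ B mB; apply: (leb_ae_measurable (iffLR (ae_lebP _) gh) (mh mD B mB)).
by move=> x /contrapT e; split=> -[Dx] /=; rewrite e.
Qed.

Lemma ae_leb_exists (R : realType) (P : R -> Prop) (t : R) :
  (0 < t)%R -> {ae leb R, forall x, P x} -> exists2 x, oint t%:E x & P x.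
Proof.
move=> t0 aeP; apply: contrapT => nex.
have : leb R (oint t%:E) = 0.
  apply: measure_negligible; first exact: borel_leb (measurable_oint _).
  apply: negligibleS (iffLR (ae_lebP _) aeP) => x tx Px; apply: nex.
  by exists x.
rewrite leb_oint ?lee_fin ?(ltW t0)// => -[] t00.
by rewrite t00 ltxx in t0.
Qed.

Lemma measurable_fine_rearr (R : realType) (mu : set R -> \bar R) (D A : set R) f :
  measurable (A : set (measurableTypeR R)) ->
  L0 A (fun t => fine (rearr mu D f t)).
Proof.
move=> mA; have mr := measurable_rearr_leb mu D f mA.
exact: (measurableT_comp (@fine_measurable R setT measurableT) mr).
Qed.

(** A function and its rearrangement are equimeasurable; an interval of length at least the mass of
    [D] truncates nothing. *)
Lemma rearr_rearr (R : realType) (mu : {measure set (lebR R) -> \bar R}) (D : set R)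
    (f : R -> \bar R) (b : \bar R) (h : R -> R) :
  measurable (D : set (lebR R)) -> measurable_fun (D : set (lebR R)) f ->
  mu D <= b ->
  {ae leb R, forall t, oint b t -> rearr mu D f t = (h t)%:E} ->
  rearr (leb R) (oint b) (EFin \o h) = rearr mu D f.
Proof.
move=> mD mf Db rh; have b0 : 0 <= b := le_trans (measure_ge0 _ _) Db.
have mJ := measurable_oint b.
apply: eq_rearr => s s0.
have db : distr mu D f s <= b.
  apply: le_trans Db; apply: le_measure; rewrite ?inE; [exact: measurable_distr_set|exact: mD|].
  by move=> x [].
have E := leb_rearr_gt mu mD mf (ltW s0) b0.
rewrite (min_idPl db) in E; rewrite -E.
have mr := measurable_rearr_leb mu D f mJ.
apply/esym; apply: (leb_ae_eq (iffLR (ae_lebP _) rh)).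
  exact: (emeasurable_fun_o_infty (borel_leb mJ) mr).
move=> t /contrapT th; split=> -[Jt st]; split => //;
  have e : (EFin \o h) t = rearr mu D f t := esym (th Jt).
  by rewrite e gee0_abs ?rearr_ge0.
by move: st; rewrite e gee0_abs ?rearr_ge0.
Qed.

Section space.
Context (R : realType) (b : \bar R) (E : banach_fun_space (oint b)).
Local Notation J := (oint b).
Local Notation m := (leb R).
Hypothesis symE : fully_symmetric E.

Let mJ : measurable (J : set (lebR R)) := borel_leb (measurable_oint b).

Lemma bfs_mem_ae g h : bfs_mem E h -> {ae m, forall t, J t -> g t = h t} ->
  bfs_mem E g /\ bfs_norm E g = bfs_norm E h.
Proof.
move=> Eh gh; have mg : L0 J g by exact: L0_ae mJ (bfs_L0 Eh) gh.
have [Eg gleh] : bfs_mem E g /\ (bfs_norm E g <= bfs_norm E h)%R.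
  apply: (bfs_solid mg Eh); apply: ae_leb_mono gh => t gh Jt.
  by rewrite gh.
split => //; apply/eqP; rewrite eq_le gleh/=.
have [] // := bfs_solid (bfs_L0 Eh) Eg.
by apply: ae_leb_mono gh => t gh Jt; rewrite gh.
Qed.

Lemma integral_rearr_lty (g : R -> R) x : bfs_mem E g -> J x ->
  \int[m]_(t in oint x%:E) rearr m J (EFin \o g) t < +oo.
Proof.
move=> Eg Jx; rewrite ltNge leye_eq; apply/negP => /eqP goo.
have mg : measurable_fun (J : set (lebR R)) (EFin \o g).
  by apply/measurable_EFinP; exact: bfs_L0 Eg.
have mO := borel_leb (measurable_oint (+oo : \bar R)).
have [x0 _] := Jx.
have alloo y : J y -> \int[m]_(t in oint y%:E) rearr m J (EFin \o g) t = +oo.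
  move=> [y0 _]; apply/eqP; rewrite -leye_eq leNgt; apply/negP => yfin.
  suff : (\int[m]_(t in oint x%:E) rearr m J (EFin \o g) t < +oo) by rewrite goo ltxx.
  rewrite (integral_rearr m mJ mg (ltW x0)); rewrite (integral_rearr m mJ mg (ltW y0)) in yfin.
  have mmin z : measurable_fun (oint +oo : set (lebR R))
      (fun s => Order.min (distr m J (EFin \o g) s) z%:E).
    have mc : measurable_fun (oint +oo : set (lebR R)) (cst z%:E : lebR R -> \bar R).
      exact: measurable_cst.
    exact: (measurable_mine (measurable_distr m mJ mg mO) mc).
  have min0 z s : (0 <= z)%R -> 0 <= Order.min (distr m J (EFin \o g) s) z%:E.
    by move=> z0; rewrite le_min measure_ge0 lee_fin.
  (* Since min(d, x) <= k min(d, y) for k = max(1, x/y), finiteness of the integral at y would give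
     finiteness at x. *)
  pose k := Num.max 1%R (x / y)%R.
  have k1 : (1 <= k)%R by rewrite le_max lexx.
  have k0 : (0 <= k)%R := le_trans ler01 k1.
  have kx : (x <= k * y)%R by rewrite -ler_pdivrMr// le_max lexx orbT.
  have min0' s : oint +oo s -> 0 <= Order.min (distr m J (EFin \o g) s) y%:E.
    by move=> _; apply: min0; exact: ltW.
  apply: (@le_lt_trans _ _ (k%:E * \int[m]_(s in oint +oo)
      Order.min (distr m J (EFin \o g) s) y%:E)); last first.
    by apply: lte_mul_pinfty => //; rewrite ?lee_fin.
  have mk : measurable_fun (oint +oo : set (lebR R)) (cst k%:E : lebR R -> \bar R).
    exact: measurable_cst.
  rewrite -(ge0_integralZl m mO (mmin y) min0'); last by rewrite lee_fin.
  apply: (ge0_le_integral m mO (fun s _ => min0 x s (ltW x0)) (mmin x)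
    (emeasurable_funM mk (mmin y))) => s _.
  rewrite mine_pMr ?lee_fin//.
  rewrite le_min !ge_min -EFinM lee_fin kx orbT andbT.
  by rewrite lee_pemull ?lee_fin// measure_ge0.
pose chi : R -> R := \1_(oint x%:E).
have xJ : oint x%:E `<=` J by apply: le_oint; case: Jx => _ /ltW.
have Echi : bfs_mem E chi.
  apply: bfs_support => //; first exact: borel_leb (measurable_oint _).
  by rewrite leb_oint ?lee_fin ?(ltW x0)// ltry.
have le_g (k : R) : (`|k| * bfs_norm E chi <= bfs_norm E g)%R.
  rewrite -(bfs_normZ k Echi); have [_ symE2] := symE.
  have Ek := bfs_scale k Echi.
  have sub : submaj J (fun x => k * chi x)%R g.
    by move=> y Jy; rewrite (alloo y Jy) leey.
  by have [_] := symE2 _ g (bfs_L0 Ek) Eg sub.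
have n0 : bfs_norm E chi = 0%R.
  apply/eqP; rewrite eq_le bfs_norm_ge0// andbT leNgt; apply/negP => n0.
  have := le_g ((bfs_norm E g + 1) / bfs_norm E chi)%R.
  have g0 : (0 <= bfs_norm E g)%R by exact: bfs_norm_ge0.
  rewrite ger0_norm; last by rewrite divr_ge0// ?ltW// ltr_wpDl.
  by rewrite divfK ?gt_eqF// leNgt ltrDl ltr01.
have [t xt] := ae_leb_exists x0 (bfs_norm_eq0 Echi n0).
by move=> /(_ (xJ _ xt)); rewrite /chi indicE mem_set// => /eqP; rewrite oner_eq0.
Qed.

End space.

(** * The formula for the gauge of M *)

Section gauge.
Context (R : realType) (a b : \bar R) (w : R -> R) (E : banach_fun_space (oint b)).
Hypothesis a0 : 0 < a.
Hypothesis w_gt0 : forall t, oint a t -> (0 < w t)%R.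
Hypothesis ndw : forall s t, oint a s -> oint a t -> (s <= t)%R -> (w t <= w s)%R.
Hypothesis bE : b = \int[leb R]_(x in oint a) (w x)%:E.
Hypothesis symE : fully_symmetric E.
Local Notation I := (oint a).
Local Notation J := (oint b).
Local Notation m := (leb R).

Let mI : measurable (I : set (lebR R)) := borel_leb (measurable_oint a).
Let mJb : measurable (J : set (measurableTypeR R)) := measurable_oint b.
Let w_ge0 t : I t -> (0 <= w t)%R. Proof. by move=> /w_gt0/ltW. Qed.

Lemma weight_primitive_gt0 x : I x -> 0 < primitive w x.
Proof.
move=> Ix; have [x0 xa] := Ix; apply: (@lt_le_trans _ _ ((w x)%:E * m (oint x%:E))).
  by rewrite leb_oint ?lee_fin ?(ltW x0)// -EFinM lte_fin mulr_gt0// w_gt0.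
have mx := borel_leb (measurable_oint x%:E).
have xI : oint x%:E `<=` I by apply: le_oint; exact: ltW.
rewrite -(integral_cst m mx (w x)%:E).
have mc : measurable_fun (oint x%:E : set (lebR R)) (cst (w x)%:E : lebR R -> \bar R).
  exact: measurable_cst.
have mw : measurable_fun (oint x%:E : set (lebR R)) (EFin \o w).
  by apply/measurable_EFinP; apply: measurable_funS (weight_L0 ndw).
have c0 y : oint x%:E y -> 0 <= cst (w x)%:E y by rewrite lee_fin w_ge0.
apply: (ge0_le_integral m mx c0 mc mw) => y xy.
rewrite lee_fin ndw//; first exact: xI.
by case: xy => _; rewrite lte_fin => /ltW.
Qed.

Lemma admissible_measure v f : admissible I w f v ->
  exists2 mu : {measure set (lebR R) -> \bar R},
    forall A, measurable (A : set (lebR R)) -> mu A = wmeas v (A `&` I) & mu I = b.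
Proof.
case=> mv v0 vw _; have [mu muE] := wmeas_measure mI mv v0.
by exists mu => //; rewrite muE// setIid (wmeas_equimeasurable a0 w_gt0 ndw mv v0 vw) bE.
Qed.

Lemma weight_measure :
  exists2 mu : {measure set (lebR R) -> \bar R},
    forall A, measurable (A : set (lebR R)) -> mu A = wmeas w (A `&` I) & mu I = b.
Proof.
have [mu muE] := wmeas_measure mI (weight_L0 ndw) w_ge0.
by exists mu => //; rewrite muE// setIid bE.
Qed.

Lemma rearr_rearr_wmeas (v : R -> R) (mu : {measure set (lebR R) -> \bar R})
    (f : R -> \bar R) (h : R -> R) :
  (forall A, measurable (A : set (lebR R)) -> mu A = wmeas v (A `&` I)) -> mu I = b ->
  measurable_fun (I : set (lebR R)) f ->
  {ae m, forall t, J t -> rearr (wmeas v) I f t = (h t)%:E} ->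
  rearr m J (EFin \o h) = rearr (wmeas v) I f.
Proof.
move=> muE mub mf; have e : rearr (wmeas v) I f = rearr mu I f.
  by apply: eq_rearr => s _; exact: distr_wmeas.
by rewrite e => rh; apply: (rearr_rearr mI mf) => //; rewrite mub.
Qed.

(** As f^*/w agrees a.e. with a real function, f^* is finite at points arbitrarily close to 0, and
    it decreases. *)
Lemma rearr_lty f : in_M I E w f ->
  forall t, I t -> rearr m I (EFin \o f) t < +oo.
Proof.
move=> [_ [[h _ hr] _]] t [t0 ta]; have [x [x0 xt] xP] := ae_leb_exists t0 hr.
have Ix : I x by split => //; exact: lt_trans ta.
apply: (@le_lt_trans _ _ (rearr m I (EFin \o f) x)).
  by apply: le_rearr; rewrite -lee_fin ltW.
rewrite ltNge leye_eq; apply/negP => /eqP roo.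
by have := xP Ix; rewrite /rearr_over roo gt0_mulye// lte_fin invr_gt0 w_gt0.
Qed.

(** Only the rearrangement of [h2] is prescribed, so [h2] may be a representative of the
    rearrangement of f/v or the function (f/v) o V^{-1}. *)
Lemma admissible_norm_le f v h1 h2 : L0 I f -> admissible I w f v ->
  bfs_mem E h2 -> L0 J h1 ->
  {ae m, forall t, J t -> rearr (wmeas w) I (rearr_over I w f) t = (h1 t)%:E} ->
  rearr m J (EFin \o h2) = rearr (wmeas v) I (EFin \o quot f v) ->
  bfs_mem E h1 /\ (bfs_norm E h1 <= bfs_norm E h2)%R.
Proof.
move=> mf adm E2 m1 r1 r2; have [mu muE mub] := weight_measure.
have mro := measurable_rearr_over f ndw.
have e1 := rearr_rearr_wmeas muE mub mro r1.
have [_ symE2] := symE; have sub : submaj J h1 h2.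
  move=> x [x0 _]; rewrite e1 r2.
  exact: (rearr_over_submaj a0 w_gt0 ndw mf adm (ltW x0)).
exact: (symE2 _ _ m1 E2 sub).
Qed.

(** Dividing the level by theta in the distribution function multiplies the rearrangement by theta.
    This pointwise bound is what lets solidity of the norm be applied. *)
Lemma rearr_quot_le f v theta : L0 I f -> admissible I w f v -> (0 < theta)%R ->
  (forall s, (0 < s)%R -> distr (wmeas v) I (EFin \o quot f v) s <=
    distr (wmeas w) I (rearr_over I w f) (s / theta)) ->
  forall t r, rearr (wmeas w) I (rearr_over I w f) t = r%:E ->
  rearr (wmeas v) I (EFin \o quot f v) t <= (theta * r)%:E.
Proof.
move=> mf adm th0 dle t r rE; have [mu muE mub] := weight_measure.
have [mu2 mu2E mu2b] := admissible_measure adm; have [mv _ _ _] := adm.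
have mro := measurable_rearr_over f ndw.
have mq : measurable_fun (I : set (lebR R)) (EFin \o quot f v).
  by apply/measurable_EFinP; exact: L0_quot.
have e1 s := distr_wmeas s mI muE mro; have e2 s := distr_wmeas s mI mu2E mq.
rewrite (eq_rearr (fun s _ => e2 s)); rewrite (eq_rearr (fun s _ => e1 s)) in rE.
have r0 : (0 <= r)%R by rewrite -lee_fin -rE rearr_ge0.
have thr0 : (0 <= theta * r)%R by rewrite mulr_ge0// ltW.
rewrite leNgt (rearr_gtP mu2 t mI mq thr0); apply/negP => /(distr_right mI mq)[s ss td].
have s0 : (0 < s)%R := le_lt_trans thr0 ss.
have : t%:E < distr mu I (rearr_over I w f) (s / theta).
  by apply: lt_le_trans td _; rewrite -e2 -e1; exact: dle.
rewrite -(rearr_gtP mu t mI mro) ?divr_ge0 ?ltW// rE lte_fin ltr_pdivrMr//.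
by rewrite mulrC ltNge (ltW ss).
Qed.

(** Shared by both claims: theta tends to 1 for the gauge and is fixed for membership. Finiteness of
    the rearrangement of f/v follows from its domination by theta times that of f^*/w. *)
Lemma exists_weight_mem f theta h1 : L0 I f -> (1 < theta)%R ->
  (forall t, I t -> rearr m I (EFin \o f) t < +oo) ->
  bfs_mem E h1 ->
  {ae m, forall t, J t -> rearr (wmeas w) I (rearr_over I w f) t = (h1 t)%:E} ->
  exists2 v, admissible I w f v &
    let h2 t := fine (rearr (wmeas v) I (EFin \o quot f v) t) in
    [/\ {ae m, forall t, J t -> rearr (wmeas v) I (EFin \o quot f v) t = (h2 t)%:E},
        bfs_mem E h2 & (bfs_norm E h2 <= theta * bfs_norm E h1)%R].
Proof.
move=> mf th1 rfin E1 r1; have th0 : (0 < theta)%R := lt_trans ltr01 th1.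
have [v adm dle] := exists_weight a0 w_gt0 ndw mf th1 rfin.
exists v => // h2.
have rle := rearr_quot_le mf adm th0 dle.
have r2 : {ae m, forall t, J t -> rearr (wmeas v) I (EFin \o quot f v) t = (h2 t)%:E}.
  apply: ae_leb_mono r1 => t r1 Jt; rewrite /h2 fineK// ge0_fin_numE ?rearr_ge0//.
  by apply: le_lt_trans (rle _ _ (r1 Jt)) _; rewrite ltry.
have [E2 n2] : bfs_mem E h2 /\ (bfs_norm E h2 <= bfs_norm E (fun x => theta * h1 x)%R)%R.
  apply: bfs_solid; [exact: measurable_fine_rearr|exact: bfs_scale|].
  apply: ae_leb_mono (ae_leb_and r1 r2) => t [r1t r2t] Jt.
  rewrite -lee_fin ger0_norm ?fine_ge0 ?rearr_ge0// -(r2t Jt).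
  apply: le_trans (rle _ _ (r1t Jt)) _.
  by rewrite lee_fin ler_norm.
split => //; apply: le_trans n2 _.
by rewrite bfs_normZ// ger0_norm// ltW.
Qed.

Lemma normM_eq f : in_M I E w f ->
  normM I E w f =
  ereal_inf [set normEv I E v (EFin \o quot f v)
            | v in [set v : R -> R | admissible I w f v]].
Proof.
move=> Mf; have [mf Evf] := Mf; have [_ [h1 E1 r1]] := Evf.
have rfin := rearr_lty Mf.
rewrite /normM (asboolT Mf) /normEv (asboolT Evf).
have r1f : {ae m, forall t, J t ->
    fine (rearr (wmeas w) I (rearr_over I w f) t) = h1 t}.
  by apply: ae_leb_mono r1 => t r1 Jt; rewrite (r1 Jt).
have [_ ->] := bfs_mem_ae E1 r1f.
apply/eqP; rewrite eq_le; apply/andP; split.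
  apply: le_ereal_inf_tmp => _ [v adm <-]; case: asboolP => [|_]; last exact: leey.
  move=> [_ [h2 E2 r2]].
  have r2f : {ae m, forall t, J t ->
      fine (rearr (wmeas v) I (EFin \o quot f v) t) = h2 t}.
    by apply: ae_leb_mono r2 => t r2 Jt; rewrite (r2 Jt).
  have [_ ->] := bfs_mem_ae E2 r2f.
  have [mu muE mub] := admissible_measure adm; have [mv _ _ _] := adm.
  have mq : measurable_fun (I : set (lebR R)) (EFin \o quot f v).
    by apply/measurable_EFinP; exact: L0_quot.
  have e2 := rearr_rearr_wmeas muE mub mq r2.
  have [_ n12] := admissible_norm_le mf adm E2 (bfs_L0 E1) r1 e2.
  by rewrite lee_fin.
apply/lee_addgt0Pr => e e0; set N := bfs_norm E h1.
have N0 : (0 <= N)%R by exact: bfs_norm_ge0.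
(* With this theta, theta N <= N + e; the 1 in the denominator allows N = 0. *)
have th1 : (1 < 1 + e / (N + 1))%R by rewrite ltrDl divr_gt0// ltr_wpDl.
have [v adm [r2 E2 n2]] := exists_weight_mem mf th1 rfin E1 r1.
apply: ge_ereal_inf; exists (normEv I E v (EFin \o quot f v)); first by exists v.
have [mv _ _ _] := adm.
rewrite /normEv asboolT; last first.
  split; last by exists (fun t => fine (rearr (wmeas v) I (EFin \o quot f v) t)).
  by exists (quot f v); [exact: L0_quot|exact: aeW].
rewrite -EFinD lee_fin; apply: le_trans n2 _.
rewrite mulrDl mul1r lerD2l -/N mulrAC ler_pdivrMr ?ltr_wpDl//.
by rewrite ler_pM2l// lerDl.
Qed.

End gauge.

(** * The generalized inverse of V and transport of v dm to J *)

Lemma wmeas_null (R : realType) (D N : set R) (v : R -> R) :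
  measurable (N : set (lebR R)) -> L0 D v -> (forall x, D x -> (0 <= v x)%R) ->
  N `<=` D -> leb R N = 0 -> wmeas v N = 0.
Proof.
move=> mN mv v0 ND N0.
have mvN : measurable_fun (N : set (lebR R)) (EFin \o v).
  apply/measurable_EFinP; move=> _ B mB.
  have mDv : measurable ((N : set (lebR R)) `&` v @^-1` B) by
    apply: (leb_ae_measurable (A := set0) (N := N));
      [exact/(negligibleP (leb R))|exact: measurable0|move=> x Nx; split=> // -[]].
  exact: mDv.
rewrite /wmeas (ge0_negligible_integral mN mN mvN _ N0).
  by rewrite setDv integral_set0.
by move=> x /ND /v0; rewrite lee_fin.
Qed.

(** Lets a transport result known for Borel sets pass to Lebesgue sets: the error is covered by a
    Borel null set, which can itself be transported. *)
Lemma lebesgue_decomp (R : realType) (A : set R) :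
  measurable (A : set (lebR R)) ->
  exists B Z : set R, [/\ measurable (B : set (measurableTypeR R)),
    measurable (Z : set (measurableTypeR R)), leb R Z = 0,
    B `<=` A & A `<=` B `|` Z].
Proof.
move=> mA; have : (completed_algebra_gen (@lebesgue_measure R)) A.
  by rewrite -g_sigma_completed_algebra_genE completed_caratheodory_measurable.
move=> [B mB [N [Z [mZ Z0 NZ]] <-]]; exists B, Z; split.
- exact: mB.
- exact: mZ.
- exact: Z0.
- exact: subsetUl.
- exact: setUS.
Qed.

Section inverse.
Context (R : realType) (a b : \bar R) (v : R -> R).
Hypothesis a0 : 0 < a.
Hypothesis mv : L0 (oint a) v.
Hypothesis v_ge0 : forall x, oint a x -> (0 <= v x)%R.
Hypothesis vb : wmeas v (oint a) = b.
Hypothesis V_fin : forall x, oint a x -> primitive v x < +oo.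
Local Notation I := (oint a).
Local Notation J := (oint b).
Local Notation m := (leb R).
Variable mu : {measure set (lebR R) -> \bar R}.
Hypothesis muE : forall A, measurable (A : set (lebR R)) -> mu A = wmeas v (A `&` I).
Local Notation V := (primitive v).
Local Notation d := (superdistr mu I -%R).

Let mI : measurable (I : set (lebR R)) := borel_leb (measurable_oint a).
Let mJ : measurable (J : set (lebR R)) := borel_leb (measurable_oint b).
Let mJb : measurable (J : set (measurableTypeR R)) := measurable_oint b.

Let muI : mu I = b. Proof. by rewrite muE// setIid. Qed.

Let mopp : L0 I -%R.
Proof. exact: (measurable_funN (@measurable_id_leb R I)). Qed.

Let mu_null (N : set R) : measurable (N : set (lebR R)) -> m N = 0 -> mu N = 0.
Proof.
move=> mN N0; rewrite muE//; apply: (wmeas_null _ mv v_ge0 (@subIsetr _ _ _)); first exact: measurableI.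
apply/eqP; rewrite eq_le measure_ge0 andbT -N0.
by apply: le_measure; rewrite ?inE//; exact: measurableI.
Qed.

Let V_ge0 x : I x -> 0 <= V x.
Proof.
move=> [_ xa]; apply: integral_ge0 => y yx; rewrite lee_fin v_ge0//.
by apply: le_oint yx; exact: ltW.
Qed.

Let dE x : I x -> d (- x)%R = V x.
Proof.
move=> [x0 xa]; have xI : oint x%:E `<=` I by apply: le_oint; exact: ltW.
have e : [set y | I y /\ (- x < - y)%R] = oint x%:E.
  apply/seteqP; split=> y /=; rewrite ltrN2; first by move=> [[y0 _] yx]; split.
  by move=> yx; split; [exact: xI|case: yx].
rewrite /superdistr e muE; last exact: borel_leb (measurable_oint _).
by rewrite setIidl.
Qed.

Let d_out c : (0 <= c)%R -> d c = 0.
Proof.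
move=> c0; rewrite /superdistr (_ : [set x | _] = set0) ?measure0//.
apply/seteqP; split=> x //= [[x0 _]]; rewrite ltrNr => xc.
by have := lt_trans x0 xc; rewrite oppr_gt0 ltNge c0.
Qed.

Let level0 c : mu [set x | I x /\ (- x)%R = c] = 0.
Proof.
have s1 : [set x | I x /\ (- x)%R = c] `<=` [set (- c)%R].
  by move=> x /= [_ <-]; rewrite opprK.
have mset1 : measurable ([set (- c)%R] : set (lebR R)).
  by have := itv_leb `[(- c)%R, (- c)%R]; rewrite set_itv1.
have ms : measurable ([set x | I x /\ (- x)%R = c] : set (lebR R)).
  apply: (leb_ae_measurable (A := set0) (N := [set (- c)%R])).
  - by apply/(negligibleP m) => //; exact: leb_set1.
  - exact: measurable0.
  - by move=> x nx; split=> // /s1.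
apply: mu_null => //; apply/eqP; rewrite eq_le measure_ge0 andbT -(leb_set1 (- c)%R).
by apply: le_measure; rewrite ?inE.
Qed.

(** The intervals (0, x) exhaust [I]. This continuity from below is read off [superlevel_right] for
    a positive function decreasing to 0 at the right end: exp(- x) if a is infinite, a - x
    otherwise. The maxima with 1 and with a/2 keep the chosen point in [I]. *)
Let d_bounded t : oint (mu I) t -> exists c, t%:E <= d c < +oo.
Proof.
rewrite muI => -[t0 tb].
suff [x Ix tx] : exists2 x, I x & t%:E < mu (oint x%:E `&` I).
  exists (- x)%R; rewrite dE// V_fin// andbT ltW//.
  move: tx; rewrite muE; last by apply: measurableI => //; exact: borel_leb (measurable_oint _).
  rewrite -setIA setIid setIidl//; apply: le_oint; case: Ix => _; exact: ltW.
have mid : L0 I id by exact: measurable_id_leb.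
case: (eqVneq a +oo) => [aoo|afin].
  have mexp : measurable_fun (I : set (lebR R)) (EFin \o (fun x : R => expR (- x))).
    apply/measurable_EFinP; exact: (measurableT_comp (@measurable_expR R) mopp).
  have [|s s0 ts] := @superlevel_right _ _ _ mu I (EFin \o (fun x : R => expR (- x))) 0%R t%:E mI mexp.
    rewrite [X in mu X](_ : _ = I) ?muI//; apply/seteqP; split=> x /=; first by case.
    by split => //; rewrite lte_fin expR_gt0.
  exists (Num.max 1 (- ln s))%R.
    by split; [rewrite lt_max ltr01|rewrite aoo ltry].
  apply: lt_le_trans ts _; apply: le_measure; rewrite ?inE.
  - exact: (emeasurable_fun_o_infty mI mexp).
  - by apply: measurableI => //; exact: borel_leb (measurable_oint _).
  - move=> x [Ix]; rewrite lte_fin => sx; split => //; split; first by case: Ix.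
    rewrite lte_fin lt_max; apply/orP; right.
    by rewrite ltrNr -ltr_expR lnK ?posrE.
have [r ar] : exists r, a = r%:E by exists (fine a); rewrite fineK// gt0_fin_numE// ltey.
have msub : measurable_fun (I : set (lebR R)) (EFin \o (fun x : R => r - x)%R).
  apply/measurable_EFinP; apply: measurable_funB => //; exact: measurable_cst.
have [|s s0 ts] := @superlevel_right _ _ _ mu I (EFin \o (fun x : R => r - x)%R) 0%R t%:E mI msub.
  rewrite [X in mu X](_ : _ = I) ?muI//; apply/seteqP; split=> x /=; first by case.
  by move=> Ix; split => //; rewrite lte_fin subr_gt0 -lte_fin -ar; case: Ix.
have r0 : (0 < r)%R by rewrite -lte_fin -ar.
exists (Num.max (r / 2) (r - s))%R.
  split; first by rewrite lt_max divr_gt0.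
  by rewrite ar lte_fin gt_max ltr_pdivrMr// ltr_pMr// ltr1n/= ltrBlDr ltrDl.
apply: lt_le_trans ts _; apply: le_measure; rewrite ?inE.
- exact: (emeasurable_fun_o_infty mI msub).
- by apply: measurableI => //; exact: borel_leb (measurable_oint _).
- move=> x [Ix]; rewrite lte_fin => sx; split => //; split; first by case: Ix.
  by rewrite lte_fin lt_max; apply/orP; right; rewrite ltrBrDl -ltrBrDr.
Qed.

Let d_small t : oint (mu I) t -> exists c, d c < t%:E.
Proof.
by move=> [t0 _]; exists 0%R; rewrite d_out.
Qed.

Let le_V x y : I x -> I y -> (x <= y)%R -> V x <= V y.
Proof.
by move=> Ix Iy xy; rewrite -!dE//; apply: le_superdistr => //; rewrite lerN2.
Qed.

Let VE x : I x -> (fine (V x))%:E = V x.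
Proof. by move=> Ix; rewrite fineK// ge0_fin_numE ?V_ge0 ?V_fin. Qed.

Let transport (C : set R) : measurable (C : set (measurableTypeR R)) ->
  mu [set x | I x /\ C (fine (V x))] = m (C `&` J).
Proof.
move=> mC; have := rank_transport mI mopp level0 d_bounded d_small mC.
rewrite muI => <-; congr (mu _); apply/seteqP; split=> x /=.
  by move=> [Ix Cx]; split => //; rewrite dE ?V_fin.
by move=> [Ix _]; rewrite dE.
Qed.

Let mpre (C : set R) : measurable (C : set (measurableTypeR R)) ->
  measurable ([set x | I x /\ C (fine (V x))] : set (lebR R)).
Proof.
move=> mC; have mfV : L0 I (fun x => fine (d (- x)%R)).
  exact: (measurableT_comp (@fine_measurable R setT measurableT) (measurable_superdistr mu mI mopp)).
have := mfV mI C mC; congr (measurable _); apply/seteqP; split=> x /=.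
  by move=> [Ix]; rewrite /= dE.
by move=> [Ix]; split => //=; rewrite dE.
Qed.

(** [rank_cut] plays the role of the intermediate value theorem. Its level c is - x for some x in
    [I], since d c is 0 when - c <= 0 and b when - c >= a. *)
Let V_onto t : J t -> exists x, Vfiber I v t x.
Proof.
move=> Jt; have Jt' : oint (mu I) t by rewrite muI.
have [c [dc _ _]] := rank_cut mI mopp level0 d_bounded d_small Jt'.
have [t0 tb] := Jt.
have c0 : (0 < - c)%R.
  rewrite oppr_gt0 ltNge; apply/negP => c0; move: dc; rewrite d_out// => -[t00].
  by rewrite -t00 ltxx in t0.
have Ic : I (- c)%R.
  split => //; rewrite ltNge; apply/negP => ac; move: tb.
  rewrite -dc /superdistr [X in mu X](_ : _ = I) ?muI ?ltxx//.
  apply/seteqP; split=> x /=; first by case.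
  move=> Ix; split => //; rewrite ltrNr -lte_fin; apply: lt_le_trans ac.
  by case: Ix.
by exists (- c)%R; split => //; rewrite -dE// opprK.
Qed.

Let U t := xget 0%R (Vfiber I v t).

Let UP t : J t -> I (U t) /\ V (U t) = t%:E.
Proof. by move=> /V_onto[x Fx]; exact: (xgetPex 0%R (ex_intro _ x Fx)). Qed.

Let fiber_interval t : is_interval (Vfiber I v t).
Proof.
move=> x y [Ix Vx] [Iy Vy] z /andP[xz zy].
have Iz : I z by apply: (is_interval_oint Ix Iy); rewrite xz.
split => //; apply/eqP; rewrite eq_le; apply/andP; split.
  by rewrite -Vy le_V.
by rewrite -Vx le_V.
Qed.

Let fiber_pos t x y : Vfiber I v t x -> Vfiber I v t y -> (x < y)%R ->
  0 < m (Vfiber I v t).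
Proof.
move=> Fx Fy xy; apply: (@lt_le_trans _ _ (m [set` `[x, y]])).
  by rewrite lebE lebesgue_measure_itv/= lte_fin xy -EFinB lte_fin subr_gt0.
apply: le_measure; rewrite ?inE; [exact: itv_leb|exact: is_interval_leb (@fiber_interval t)|].
by move=> z; rewrite /= in_itv/=; exact: fiber_interval.
Qed.

Let flat := [set t | 0 < m (Vfiber I v t)].

(** A fiber of positive measure is a nondegenerate interval, hence contains a rational, at which V
    takes the value t. *)
Let countable_flat : countable flat.
Proof.
apply: (@sub_countable _ _ _ [set fine (V (ratr q)) | q in [set: rat]]); last first.
  by apply: (sub_countable (card_image_le _ _)); exact: countableP.
apply: subset_card_le => t; rewrite /flat /= => mt.
have [x [y [Fx Fy xy]]] : exists x y, [/\ Vfiber I v t x, Vfiber I v t y & (x < y)%R].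
  apply: contrapT => nxy.
  have [e|/set0P[x Fx]] := eqVneq (Vfiber I v t) set0.
    by move: mt; rewrite e measure0 ltxx.
  suff s : Vfiber I v t `<=` [set x].
    have : m (Vfiber I v t) <= m [set x].
      apply: le_measure; rewrite ?inE; [exact: is_interval_leb (@fiber_interval t)| |exact: s].
      by have := itv_leb `[x, x]; rewrite set_itv1.
    by rewrite leb_set1 leNgt mt.
  move=> y Fy /=; apply/eqP; case: ltgtP => // h; exfalso; apply: nxy.
    by exists y, x.
  by exists x, y.
have [q] := rat_in_itvoo xy; rewrite in_itv/= => /andP[xq qy].
have [_ Vq] : Vfiber I v t (ratr q).
  by apply: (fiber_interval Fx Fy); rewrite !ltW.
by exists q => //; rewrite Vq.
Qed.

Let UV x : I x -> ~ flat (fine (V x)) -> U (fine (V x)) = x.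
Proof.
move=> Ix nf; have Fx : Vfiber I v (fine (V x)) x by split => //; rewrite VE.
have FU : Vfiber I v (fine (V x)) (U (fine (V x))) := xgetPex 0%R (ex_intro _ x Fx).
apply/eqP; case: ltgtP => // h; exfalso; apply: nf.
  exact: fiber_pos FU Fx h.
exact: fiber_pos Fx FU h.
Qed.

(** Any choice of points in the fibers is monotone because V is. *)
Let mU : measurable_fun (J : set (measurableTypeR R)) U.
Proof.
have : measurable_fun (J : set (measurableTypeR R)) (fun t => - U t)%R.
  apply: nonincreasing_measurable_fun; first exact: is_interval_oint.
  move=> s t Js Jt st; rewrite lerN2 leNgt; apply/negP => h.
  have [IUs Vs] := UP Js; have [IUt Vt] := UP Jt.
  have : V (U t) <= V (U s) by apply: le_V => //; exact: ltW.
  rewrite Vs Vt lee_fin => ts; have e : s = t by apply/eqP; rewrite eq_le st.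
  by rewrite e ltxx in h.
move=> /measurable_funN; apply: eq_measurable_fun => t _ /=.
by rewrite opprK.
Qed.

(** Up to flat levels this is the image of [A] under V, written as a preimage under [U]. *)
Let lift (A : set R) := [set t | [/\ J t, ~ flat t & A (U t)]].

Let flatC_borel : measurable (~` flat : set (measurableTypeR R)).
Proof. by apply: measurableC; exact: countable_measurable. Qed.

(** Pulled back by V, [lift B] agrees with [B] on [I] except where V takes a flat value or one
    outside [J]. That exceptional set is [mu]-null by transport, as flat values are countable. *)
Let lift_borel (B : set R) : measurable (B : set (measurableTypeR R)) ->
  measurable (lift B : set (measurableTypeR R)) /\ m (lift B) = mu (B `&` I).
Proof.
move=> mB; have mL : measurable (lift B : set (measurableTypeR R)).
  have := measurableI _ _ (mU mJb mB) flatC_borel.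
  by congr (measurable _); apply/seteqP; split=> t /=; [case=> -[]|case].
split => //; pose X := [set x | I x /\ (~` (J `\` flat)) (fine (V x))].
have mC : measurable (~` (J `\` flat) : set (measurableTypeR R)).
  by apply: measurableC; rewrite setDE; exact: measurableI.
have mX : measurable (X : set (lebR R)) by exact: mpre mC.
have X0 : mu X = 0.
  apply: (etrans (transport mC)); apply: leb_countable; apply: sub_countable countable_flat.
  apply: subset_card_le => t [/= nt Jt]; apply: contrapT => ft; exact: nt.
have -> : m (lift B) = mu [set x | I x /\ lift B (fine (V x))].
  by rewrite transport//; congr (m _); apply/seteqP; split=> t /=; [move=> h; split => //; case: h|case].
apply: (measure_eq_off (mpre mL) _ mX X0); first by apply: measurableI => //; exact: borel_leb.
move=> x nX; split.
  move=> [Ix [_ nf]]; rewrite UV//; split => //.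
move=> [Bx Ix]; split => //; have [Jx nf] : (J `\` flat) (fine (V x)).
  by apply: contrapT => h; apply: nX.
by split => //; rewrite UV.
Qed.

(** Squeeze [A] between Borel sets differing by a null set [Z]. As v dm is absolutely continuous,
    [Z] is [mu]-null and its lift is Lebesgue null. *)
Let lift_leb (A : set R) : measurable (A : set (lebR R)) -> A `<=` I ->
  measurable (lift A : set (lebR R)) /\ m (lift A) = mu A.
Proof.
move=> mA AI; have [B [Z [mB mZ Z0 BA ABZ]]] := lebesgue_decomp mA.
have [mLB LB] := lift_borel mB; have [mLZ LZ] := lift_borel mZ.
have muZ : mu Z = 0 by apply: mu_null => //; exact: borel_leb.
have nLZ : m.-negligible (lift Z : set (lebR R)).
  apply/(negligibleP m); first exact: borel_leb.
  apply: (etrans LZ); apply/eqP; rewrite eq_le measure_ge0 andbT -muZ.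
  apply: le_measure; rewrite ?inE; [|exact: borel_leb|exact: subIsetl].
  by apply: measurableI => //; exact: borel_leb.
have eL t : ~ lift Z t -> lift B t <-> lift A t.
  move=> nZ; split=> -[Jt nf At]; split => //; first exact: BA.
  by case: (ABZ _ At) => // Zt; case: nZ.
split; first exact: leb_ae_measurable nLZ (borel_leb mLB) eL.
rewrite -(leb_ae_eq nLZ (borel_leb mLB) eL) LB.
rewrite (_ : B `&` I = B); last by apply: setIidl; exact: subset_trans AI.
apply: (measure_eq_off (borel_leb mB) mA (borel_leb mZ) muZ) => x nZ.
by split; [exact: BA|case/ABZ].
Qed.

Variable g : R -> R.
Hypothesis mg : L0 I g.

Let comp_VinvE t : ~ flat t -> comp_Vinv I v g t = g (U t).
Proof. by move=> nf; rewrite /comp_Vinv asboolF. Qed.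

Lemma comp_Vinv_L0 : L0 J (comp_Vinv I v g).
Proof.
move=> _ C mC; have [mL _] := lift_leb (mg mI mC) (@subIsetl _ _ _).
apply: (leb_ae_measurable (negligible_countable countable_flat) mL) => t nf.
split=> [[Jt _ [_ Ct]]|[Jt Ct]]; first by split => //=; rewrite comp_VinvE.
split => //; split; first by have [] := UP Jt.
by rewrite /= -comp_VinvE.
Qed.

Lemma rearr_comp_Vinv :
  rearr m J (EFin \o comp_Vinv I v g) = rearr (wmeas v) I (EFin \o g).
Proof.
have mEg : measurable_fun (I : set (lebR R)) (EFin \o g) by exact/measurable_EFinP.
apply: eq_rearr => s s0; rewrite (distr_wmeas s mI muE mEg).
have mA := measurable_distr_set mI s mEg.
have [mL LE] : measurable (lift [set x | I x /\ s%:E < `|(EFin \o g) x|] : set (lebR R)) /\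
    m (lift [set x | I x /\ s%:E < `|(EFin \o g) x|]) = distr mu I (EFin \o g) s.
  by apply: lift_leb => // x [].
rewrite -LE; apply/esym/(leb_ae_eq (negligible_countable countable_flat) mL) => t nf.
split=> [[Jt _ [_ st]]|[Jt st]]; first by split => //=; rewrite comp_VinvE.
split => //; split; first by have [] := UP Jt.
by rewrite /= -comp_VinvE.
Qed.

End inverse.

(** * Membership in M through composition with the inverse of V *)

Section composition.
Context (R : realType) (a b : \bar R) (w f : R -> R) (E : banach_fun_space (oint b)).
Hypothesis a0 : 0 < a.
Hypothesis w_gt0 : forall t, oint a t -> (0 < w t)%R.
Hypothesis ndw : forall s t, oint a s -> oint a t -> (s <= t)%R -> (w t <= w s)%R.
Hypothesis bE : b = \int[leb R]_(x in oint a) (w x)%:E.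
Hypothesis symE : fully_symmetric E.
Hypothesis W_fin : forall t, oint a t -> primitive w t < +oo.
Hypothesis mf : L0 (oint a) f.
Local Notation I := (oint a).
Local Notation J := (oint b).
Local Notation m := (leb R).

Let mI : measurable (I : set (lebR R)) := borel_leb (measurable_oint a).
Let mJb : measurable (J : set (measurableTypeR R)) := measurable_oint b.

Lemma comp_Vinv_quot v : admissible I w f v ->
  L0 J (comp_Vinv I v (quot f v)) /\
  rearr m J (EFin \o comp_Vinv I v (quot f v)) =
    rearr (wmeas v) I (EFin \o quot f v).
Proof.
move=> adm; have [mv v0 vw _] := adm.
have [mu muE mub] := admissible_measure a0 w_gt0 ndw bE adm.
have vb : wmeas v I = b by rewrite (wmeas_equimeasurable a0 w_gt0 ndw mv v0 vw) bE.
have V_fin x : I x -> primitive v x < +oo.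
  move=> Ix; apply: le_lt_trans (W_fin Ix).
  exact: (primitive_equimeasurable_le a0 w_gt0 ndw mv v0 vw).
have mq : L0 I (quot f v) by exact: L0_quot.
split.
  exact: (comp_Vinv_L0 a0 mv v0 vb V_fin muE mq).
exact: (rearr_comp_Vinv a0 mv v0 vb V_fin muE mq).
Qed.

Lemma in_M_comp_Vinv : in_M I E w f ->
  exists2 v, admissible I w f v & bfs_mem E (comp_Vinv I v (quot f v)).
Proof.
move=> Mf; have [_ [_ [h1 E1 r1]]] := Mf.
(* Any theta > 1 serves here, as only membership is at stake. *)
have th1 : (1 < 2 :> R)%R by rewrite ltr1n.
have [v adm [r2 E2 _]] := exists_weight_mem a0 w_gt0 ndw bE mf th1 (rearr_lty w_gt0 Mf) E1 r1.
exists v => //; have [mg rg] := comp_Vinv_quot adm.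
have [mu muE mub] := admissible_measure a0 w_gt0 ndw bE adm; have [mv _ _ _] := adm.
have mq : measurable_fun (I : set (lebR R)) (EFin \o quot f v).
  by apply/measurable_EFinP; exact: L0_quot.
have e2 := rearr_rearr_wmeas muE mub mq r2.
have [_ symE2] := symE.
have sub : submaj J (comp_Vinv I v (quot f v))
    (fun t => fine (rearr (wmeas v) I (EFin \o quot f v) t)).
  by move=> x _; rewrite rg e2.
by have [] := symE2 _ _ mg E2 sub.
Qed.

Lemma comp_Vinv_in_M v : admissible I w f v ->
  bfs_mem E (comp_Vinv I v (quot f v)) -> in_M I E w f.
Proof.
move=> adm Eg; have [mg rg] := comp_Vinv_quot adm.
have mro := measurable_rearr_over f ndw.
have [mu muE mub] := weight_measure w_gt0 ndw bE.
have e1 s := distr_wmeas s mI muE mro.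
pose r1 := rearr (wmeas w) I (rearr_over I w f).
have r1_fin t : J t -> r1 t < +oo.
  move=> Jt; have [t0 _] := Jt; rewrite ltNge leye_eq; apply/negP => /eqP roo.
  have mt := borel_leb (measurable_oint t%:E).
  have := integral_rearr_lty symE Eg Jt; rewrite rg ltNge => /negP; apply.
  apply: le_trans (rearr_over_submaj a0 w_gt0 ndw mf adm (ltW t0)).
  apply: (@le_trans _ _ (\int[m]_(s in oint t%:E) cst +oo s)).
    by rewrite (integral_cst m mt) leb_oint ?lee_fin ?(ltW t0)// gt0_mulye ?lte_fin.
  have mc : measurable_fun (oint t%:E : set (lebR R)) (cst +oo : lebR R -> \bar R).
    exact: measurable_cst.
  have mr := measurable_rearr_leb (wmeas w) I (rearr_over I w f) (measurable_oint t%:E).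
  apply: (ge0_le_integral m mt _ mc mr); first by move=> s _; exact: leey.
  move=> s [_ st]; rewrite -roo; apply: le_rearr.
  by rewrite -lee_fin ltW.
have r1E t : J t -> r1 t = (fine (r1 t))%:E.
  by move=> Jt; rewrite fineK// ge0_fin_numE ?rearr_ge0// r1_fin.
have ae1 : {ae m, forall t, J t -> r1 t = (fine (r1 t))%:E} by apply: aeW => t; exact: r1E.
have m1 : L0 J (fun t => fine (r1 t)) := measurable_fine_rearr _ _ _ mJb.
have [E1 _] := admissible_norm_le a0 w_gt0 ndw bE symE mf adm Eg m1 ae1 rg.
have f_fin t : I t -> rearr m I (EFin \o f) t < +oo.
  move=> It; have [t0 ta] := It; rewrite ltNge leye_eq; apply/negP => /eqP roo.
  have tI : oint t%:E `<=` I by apply: le_oint; exact: ltW.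
  have mt := borel_leb (measurable_oint t%:E).
  have W0 := weight_primitive_gt0 w_gt0 ndw It.
  have muW : mu (oint t%:E) = primitive w t by rewrite muE// setIidl.
  have WE : primitive w t = (fine (primitive w t))%:E.
    by rewrite fineK// ge0_fin_numE ?W_fin// ltW.
  (* If f^* were infinite at t, then f^*/w would be infinite on (0, t), of w-mass W(t) > 0, so its
     rearrangement would be infinite on (0, W(t)) and in particular at the midpoint [y]. *)
  pose y := (fine (primitive w t) / 2)%R.
  have Wp : (0 < fine (primitive w t))%R by rewrite -lte_fin -WE.
  have yW : y%:E < primitive w t.
    by rewrite WE lte_fin ltr_pdivrMr// ltr_pMr// ltr1n.
  have Jy : J y.
    split; first by rewrite divr_gt0.
    apply: lt_le_trans yW _; rewrite -muW -mub; apply: le_measure; rewrite ?inE//.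
  have := r1E _ Jy; set r := fine _ => rE.
  have r0 : (0 <= r)%R by rewrite -lee_fin -rE rearr_ge0.
  have : r%:E < rearr mu I (rearr_over I w f) y.
    rewrite (rearr_gtP mu y mI mro r0); apply: lt_le_trans yW _; rewrite -muW.
    apply: le_measure; rewrite ?inE//; first exact: measurable_distr_set.
    move=> x tx; have Ix := tI _ tx; split => //.
    have xoo : rearr m I (EFin \o f) x = +oo.
      apply/eqP; rewrite -leye_eq -roo; apply: le_rearr.
      by case: tx => _; rewrite lte_fin => /ltW.
    by rewrite /rearr_over xoo gt0_mulye ?lte_fin ?invr_gt0 ?w_gt0//= ltry.
  by rewrite -(eq_rearr (fun s _ => e1 s)) -/r1 rE ltxx.
split => //; split; last by exists (fun t => fine (r1 t)).
exists (fun t => fine (rearr_over I w f t)).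
  exact: (measurableT_comp (@fine_measurable R setT measurableT) mro).
apply: aeW => t It; rewrite fineK// ge0_fin_numE; last exact: rearr_over_ge0.
have := f_fin _ It; have := rearr_ge0 m I (EFin \o f) t; rewrite /rearr_over.
by case: (rearr m I (EFin \o f) t) => [r _ _|//|//]; rewrite -EFinM ltry.
Qed.

End composition.

Theorem proposition4p2 (R : realType) (a b : \bar R) (w : R -> R)
    (E : banach_fun_space (oint b)) :
  0 < a ->
  (forall t : R, oint a t -> (0 < w t)%R) ->
  (forall s t : R, oint a s -> oint a t -> (s <= t)%R -> (w t <= w s)%R) ->
  b = \int[leb R]_(x in oint a) (w x)%:E ->
  fully_symmetric E ->
  (forall f : R -> R, in_M (oint a) E w f ->
     normM (oint a) E w f =
     ereal_inf [set normEv (oint a) E v (EFin \o quot f v)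
               | v in [set v : R -> R | admissible (oint a) w f v]])
  /\
  ((forall t : R, oint a t -> primitive w t < +oo) ->
   forall f : R -> R, L0 (oint a) f ->
     (in_M (oint a) E w f <->
      exists2 v : R -> R, admissible (oint a) w f v &
        bfs_mem E (comp_Vinv (oint a) v (quot f v)))).
Proof.
move=> a0 w_gt0 ndw bE symE; split; first exact: normM_eq.
move=> W_fin f mf; split; first exact: in_M_comp_Vinv.
by move=> [v]; exact: comp_Vinv_in_M.
Qed.
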